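(* Let $d\ge2$, fix a real $s>0$ and an integer $k\in\{1,\dots,d\}$. There is a constant $C>0$ (depending on $d$, $k$) such that for all $\delta$ with $CN^{-\nu(d,k)}\log N\le\delta\le1$ we have $$I^\flat_{s,d}(\delta;N)\ge\delta^dN^{d+s-s(d)+o(1)}\max\bigl\{1,\ (\delta^{1/\nu(d,k)}N)^{s-d}\bigr\}.$$
   Context: For integers $d,N\ge1$ and $\mathbf x=(x_1,\dots,x_d)\in\mathsf T_d=[0,1)^d$ (identified with $(\mathbb R/\mathbb Z)^d$), let $S_d(\mathbf x;N)=\sum_{n=1}^N\exp\bigl(2\pi i(x_1n+\dots+x_dn^d)\bigr)$. For real $s>0$, $\delta\in(0,1]$ and $\boldsymbol\xi\in\mathsf T_d$, let $I_{s,d}(\delta,\boldsymbol\xi;N)=\int_{\boldsymbol\xi+[0,\delta]^d}|S_d(\mathbf x;N)|^{2s}d\mathbf x$ (the integrand is 1-periodic in each coordinate), and $I^\flat_{s,d}(\delta;N)=\inf_{\boldsymbol\xi\in\mathsf T_d}I_{s,d}(\delta,\boldsymbol\xi;N)$. Write $s(d)=d(d+1)/2$ and $\nu(d,k)=\min\{\frac1{2k},\frac1{2d-k}\}$. A bound $X\ge N^{c+o(1)}$ means: for every $\varepsilon>0$ there is $N_0$ depending only on $\varepsilon,d,s,k$ such that $X\ge N^{c-\varepsilon}$ for all $N\ge N_0$, uniformly in $\delta$. *)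

(* Defs.v *)
From HB Require Import structures.
From mathcomp Require Import all_boot all_order all_algebra complex.
From mathcomp Require Import all_classical all_reals all_analysis.

Set Implicit Arguments.
Unset Strict Implicit.
Unset Printing Implicit Defensive.

Import Order.TTheory GRing.Theory Num.Theory.
Import numFieldNormedType.Exports.

Local Open Scope classical_set_scope.
Local Open Scope ring_scope.

(* The library has Lebesgue measure on R only. On R^n it is built by recursion
   on n: the pushforward of the product measure on R * R^(n-1) under cons. *)
Section lebesgue_cons.
Context (R : realType) (n : nat).
Variable m : {sigma_finite_measure set (n.-tuple R) -> \bar R}.

Definition tcons (p : R * n.-tuple R) : n.+1.-tuple R := [tuple of p.1 :: p.2].

Lemma measurable_tcons : measurable_fun [set: R * n.-tuple R] tcons.
Proof. exact: measurable_cons. Qed.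

Definition lebesgue_cons : set (n.+1.-tuple R) -> \bar R :=
  pushforward (@lebesgue_measure R \x m)%E tcons.

Let lebesgue_cons0 : lebesgue_cons set0 = 0%E.
Proof. by rewrite /lebesgue_cons /pushforward preimage_set0 measure0. Qed.

Let lebesgue_cons_ge0 A : (0 <= lebesgue_cons A)%E.
Proof. by rewrite /lebesgue_cons /pushforward measure_ge0. Qed.

Let lebesgue_cons_sigma_additive : semi_sigma_additive lebesgue_cons.
Proof.
move=> F mF tF mUF; rewrite /lebesgue_cons /pushforward preimage_bigcup.
apply: measure_semi_sigma_additive.
- by move=> i; rewrite -[X in measurable X]setTI; exact: measurable_tcons.
- apply/trivIsetP => /= i j _ _ ij; rewrite -preimage_setI.
  by move/trivIsetP : tF => /(_ _ _ _ _ ij) ->//; rewrite preimage_set0.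
- rewrite -preimage_bigcup -[X in measurable X]setTI.
  exact: measurable_tcons.
Qed.

HB.instance Definition _ := isMeasure.Build _ _ _ lebesgue_cons
  lebesgue_cons0 lebesgue_cons_ge0 lebesgue_cons_sigma_additive.

Let lebesgue_cons_sigma_finite : sigma_finite setT lebesgue_cons.
Proof.
have /sigma_finiteP[F [FT ndF Foo]] := sigma_finiteT (@lebesgue_measure R).
have /sigma_finiteP[G [GT ndG Goo]] := sigma_finiteT m.
pose uncons (t : n.+1.-tuple R) := (thead t, [tuple of behead t]).
have muncons : measurable_fun setT uncons.
  apply: measurable_fun_pair; last exact: measurable_behead.
  exact: measurable_tnth.
have unconsK p : uncons (tcons p) = p.
  by case: p => x t; congr (_, _); apply/val_inj.
exists (fun i => uncons @^-1` (F i `*` G i)).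
  rewrite -preimage_bigcup; apply/esym/seteqP; split => // t _.
  have [i _ Fi] : (\bigcup_i F i) (uncons t).1 by rewrite -FT.
  have [j _ Gj] : (\bigcup_i G i) (uncons t).2 by rewrite -GT.
  exists (maxn i j) => //; split.
  - by move: Fi; exact/subsetPset/ndF/leq_maxl.
  - by move: Gj; exact/subsetPset/ndG/leq_maxr.
move=> i; have [mF Fi] := Foo i; have [mG Gi] := Goo i; split.
  by rewrite -[X in measurable X]setTI; apply: muncons => //; exact: measurableX.
rewrite /lebesgue_cons /pushforward -comp_preimage.
rewrite (_ : uncons \o tcons = id); last by apply/funext => p; exact: unconsK.
by rewrite preimage_id product_measure1E// lte_mul_pinfty// ge0_fin_numE.
Qed.

HB.instance Definition _ := Measure_isSigmaFinite.Build _ _ _ lebesgue_cons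
  lebesgue_cons_sigma_finite.

End lebesgue_cons.

Fixpoint lebesgue_tuple (R : realType) (n : nat) :
    {sigma_finite_measure set (n.-tuple R) -> \bar R} :=
  if n is n'.+1 then lebesgue_cons (lebesgue_tuple R n')
  else @dirac _ (0.-tuple R) [tuple] R.

Lemma lebesgue_tupleX (R : realType) (n : nat) (A : 'I_n -> set R) :
  (forall i, measurable (A i)) ->
  lebesgue_tuple R n [set x | forall i, A i (tnth x i)] =
  (\prod_(i < n) lebesgue_measure (A i))%E.
Proof.
elim: n A => [|n IH] A mA.
  rewrite big_ord0 /= /dirac indicE mem_set//=; by case.
rewrite big_ord_recl -IH//= /lebesgue_cons /pushforward.
rewrite -product_measure1E; [|exact: mA|]; last first.
  rewrite (_ : [set x | _] =
      \bigcap_(i : 'I_n) ((@tnth n R ^~ i) @^-1` A (lift ord0 i))).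
    apply: fin_bigcap_measurable => // i _.
    by rewrite -[X in measurable X]setTI; apply: measurable_tnth.
  by apply/seteqP; split => x /= xA i; [move=> _|]; apply: xA.
congr (_ _); apply/seteqP; split => -[x t] /=.
  by move=> xtA; split; [exact: (xtA ord0)|move=> i; have := xtA (lift ord0 i);
    rewrite tnthS].
move=> [xA tA] i; case: (unliftP ord0 i) => [j ->|->//].
by rewrite tnthS; exact: tA.
Qed.

(* e(t) = exp(2 pi i t) *)
Definition cexp2pi (R : realType) (t : R) : R[i] :=
  Complex (cos (2 * pi * t)) (sin (2 * pi * t)).

(* Index j : 'I_d stands for the coordinate x_{j+1}. *)
Definition weyl_sum (R : realType) (d : nat) (x : d.-tuple R) (N : nat) : R[i] :=
  \sum_(1 <= n < N.+1) cexp2pi (\sum_(j < d) tnth x j * n%:R ^+ j.+1).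

Definition torus (R : realType) (d : nat) : set (d.-tuple R) :=
  [set xi | forall i, 0 <= tnth xi i < 1].

Definition cube (R : realType) (d : nat) (delta : R) (xi : d.-tuple R) :
    set (d.-tuple R) :=
  [set x | forall i, tnth xi i <= tnth x i <= tnth xi i + delta].

Definition mean_value (R : realType) (d : nat) (s delta : R) (xi : d.-tuple R)
    (N : nat) : \bar R :=
  (\int[lebesgue_tuple R d]_(x in cube delta xi)
     (Normc.normc (weyl_sum x N) `^ (2 * s))%:E)%E.

Definition inf_mean_value (R : realType) (d : nat) (s delta : R) (N : nat) :
    \bar R :=
  ereal_inf [set mean_value s delta xi N | xi in @torus R d].

Definition s_crit (R : realType) (d : nat) : R := (d * d.+1)%:R / 2.

Definition nu (R : realType) (d k : nat) : R :=
  Num.min (2 * k%:R)^-1 (2 * d%:R - k%:R)^-1.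

(* Main.v *)
Require Import Defs.
From HB Require Import structures.
From mathcomp Require Import all_boot all_order all_algebra complex.
From mathcomp Require Import all_classical all_reals all_analysis.
From mathcomp Require Import measurable_realfun ring lra zify.

(** Two regimes of [s] are treated separately, and in both only [nu <= 1/3] is
    used, so that [N delta^3] is bounded below.

    For [s <= s(d)]: averaging [|S|^2] with Fejer weights over a fine grid in the
    cube, the off-diagonal pairs [n <> m] contribute little because
    [(n - m, n^2 - m^2)] determines [(n, m)]; hence the mean square of [S] over
    the cube is of order [N].  The bound follows by integrating an inequality
    [A (t^2 - tau) <= t^(2 s)], valid for [0 <= t <= N].

    For [s >= s(d)]: the cube contains a point [a/q] with [q = 3^m] of order
    [1/delta] such that 3 does not divide [a_2] but divides [a_j] for [j >= 3].
    For such [a] the complete sum modulo [q] has modulus exactly [sqrt q], so [|S|]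
    is of order [N / sqrt q] on a box around [a/q] with sides of order
    [q^(-1/2) N^(-j)], and this single box already gives the bound. *)

Set Implicit Arguments.
Unset Strict Implicit.
Unset Printing Implicit Defensive.

Import Order.TTheory GRing.Theory Num.Theory.
Import numFieldNormedType.Exports.

Local Open Scope classical_set_scope.
Local Open Scope complex_scope.
Local Open Scope ring_scope.

(** * The additive character *)

Section Exponential.
Context {R : realType}.
Implicit Types (t u : R) (z : R[i]).
Local Notation e := (@cexp2pi R).

Lemma cexp2piD t u : e (t + u) = e t * e u.
Proof.
rewrite /cexp2pi mulrDr cosD sinD; apply/eqP.
by rewrite eq_complex /= addrC !eqxx [X in _ == X]addrC eqxx.
Qed.

Lemma cexp2pi0 : e 0 = 1.
Proof. by rewrite /cexp2pi mulr0 cos0 sin0. Qed.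

Lemma cexp2piN t : e (- t) = (e t)^*.
Proof. by rewrite /cexp2pi mulrN cosN sinN. Qed.

Lemma cexp2piM t n : e (t * n%:R) = e t ^+ n.
Proof.
elim: n => [|n IH]; first by rewrite mulr0 cexp2pi0 expr0.
by rewrite -natr1 mulrDr mulr1 cexp2piD IH exprSr.
Qed.

Lemma cexp2pi_nat n : e n%:R = 1.
Proof.
have e1 : e 1 = 1 by rewrite /cexp2pi mulr1 mulr_natl cos2pi sin2pi.
by rewrite -[n%:R]mul1r cexp2piM e1 expr1n.
Qed.

Lemma cexp2pi_int (n : int) : e n%:~R = 1.
Proof.
case: n => n; first exact: cexp2pi_nat.
by rewrite NegzE mulrNz cexp2piN [X in e X](_ : _ = n.+1%:R) // cexp2pi_nat rmorph1.
Qed.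

(** By the half-angle formula the real part is 1 - 2 sin^2 of [pi * t], and this sine is positive
    for 0 < t < 1. *)
Lemma cexp2pi_neq1 t : 0 < t < 1 -> e t != 1.
Proof.
move=> /andP[t0 t1]; apply/eqP => -[+ _].
rewrite (_ : 2 * pi * t = (pi * t) *+ 2); last by rewrite -[RHS]mulr_natl mulrA.
rewrite cos_mulr2n cos2sin2 => h.
have : 0 < sin (pi * t).
  by apply: sin_gt0_pi; rewrite mulr_gt0 ?pi_gt0//= gtr_pMr ?pi_gt0.
move=> /(mulr_gt0 (ltr01 : 0 < 1)); rewrite mul1r => s0.
have : 0 < sin (pi * t) ^+ 2 by rewrite exprn_gt0.
by move: h; rewrite -[X in X - 1]mulr_natl; lra.
Qed.

Lemma mulcJ_cexp2pi t : e t * (e t)^* = 1.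
Proof. by rewrite -cexp2piN -cexp2piD subrr cexp2pi0. Qed.

Lemma norm_cexp2pi t : `|e t| = 1.
Proof. by apply/eqP; rewrite -sqrp_eq1// sqr_normc mulcJ_cexp2pi. Qed.

Lemma normcE_complex z : `|z| = (Normc.normc z)%:C.
Proof. by []. Qed.

Lemma normc_ge0 z : 0 <= Normc.normc z.
Proof. by case: z => a b; exact: sqrtr_ge0. Qed.

Lemma lipschitz1_derive (f df : R -> R) (x y : R) :
  (forall w : R, is_derive w (1 : R) f (df w)) -> (forall w, `|df w| <= 1) ->
  `|f x - f y| <= `|x - y|.
Proof.
move=> fd df1; wlog yx : x y / y <= x.
  by move=> H; have [|/ltW] := leP y x; [|rewrite distrC (distrC x)]; exact: H.
have cf : continuous f.
  by move=> w; apply: differentiable_continuous; apply/derivable1_diffP; case: (fd w).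
have [c _ ->] := MVT_segment yx (fun w _ => fd w) (continuous_subspaceT cf).
by rewrite normrM ler_piMl.
Qed.

(** The factor is 4 pi rather than 2 pi because the real and imaginary parts, each 2 pi-Lipschitz,
    are bounded separately and added. *)
Lemma norm_cexp2piB t u : `|e t - e u| <= (4 * pi * `|t - u|)%:C.
Proof.
set a := 2 * pi * t; set b := 2 * pi * u.
have ab : `|a - b| = 2 * pi * `|t - u|.
  by rewrite -mulrBr normrM ger0_norm// mulr_ge0// pi_ge0.
have s : `|sin a - sin b| <= `|a - b|.
  by apply: (@lipschitz1_derive sin cos) => z; exact: cos_max.
have c : `|cos a - cos b| <= `|a - b|.
  by apply: (@lipschitz1_derive cos (fun x => - sin x)) => z; rewrite normrN sin_max.
have -> : e t - e u = (cos a - cos b)%:C + 'i%C * (sin a - sin b)%:C.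
  by rewrite [LHS]complexE.
apply: le_trans (ler_normD _ _) _; rewrite normrM !normc_def/= !expr0n/=.
rewrite addr0 add0r expr1n sqrtr1 mul1r !addr0 !sqrtr_sqr.
by rewrite -rmorphD lecR (le_trans (lerD c s))// ab; lra.
Qed.

End Exponential.

(** * Complete sums modulo a power of 3 *)

Section GaussSum.

Lemma sum_periodic_shift (V : zmodType) (q t : nat) (F : nat -> V) :
  (forall n, F (n + q)%N = F n) -> \sum_(i < q) F (i + t)%N = \sum_(i < q) F i.
Proof.
move=> Fq; elim: t => [|t <-]; first by apply: eq_bigr => i _; rewrite addn0.
case: q Fq => [|q] Fq; first by rewrite !big_ord0.
rewrite big_ord_recr big_ord_recl add0n (_ : (q + t.+1 = t + q.+1)%N); last by lia.
by rewrite Fq addrC; congr (_ + _); apply: eq_bigr => i _; rewrite /bump/= addSnnS.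
Qed.

(** The mixed second difference of [x ^+ j] vanishes at [y = 0] and at [z = 0], hence is a multiple
    of [y * z]. In the induction it becomes [x] times the old one, plus [y] and [z] times first
    differences that are divisible by [z] and [y]. *)
Lemma exp_mixed_difference (x y z : int) (j : nat) :
  exists w : int, (x + y + z) ^+ j + x ^+ j = (x + y) ^+ j + (x + z) ^+ j + y * z * w.
Proof.
elim: j => [|j [w IH]]; first by exists 0; rewrite !expr0; ring.
have [v hv] : exists v, (x + y + z) ^+ j - (x + y) ^+ j = z * v.
  by rewrite subrXX; eexists; congr (_ * _); ring.
have [v' hv'] : exists v, (x + y + z) ^+ j - (x + z) ^+ j = y * v.
  by rewrite subrXX; eexists; congr (_ * _); ring.
exists (x * w + v + v'); apply/eqP; rewrite -subr_eq0; apply/eqP.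
rewrite !exprS.
transitivity (x * ((x + y + z) ^+ j + x ^+ j - ((x + y) ^+ j + (x + z) ^+ j + y * z * w))
  + y * ((x + y + z) ^+ j - (x + y) ^+ j - z * v)
  + z * ((x + y + z) ^+ j - (x + z) ^+ j - y * v')); first by ring.
by rewrite IH hv hv' !subrr !mulr0 !addr0.
Qed.

(** The phase polynomial, over [int] so that differences and divisibility can be handled exactly;
    the exponent [j.+1] matches [weyl_sum]. *)
Definition int_poly d (a : 'I_d -> nat) (n : int) : int :=
  \sum_(j < d) (a j)%:Z * n ^+ j.+1.

Lemma int_poly_period d (a : 'I_d -> nat) (n m : int) :
  exists w, int_poly a (n + m) = int_poly a n + m * w.
Proof.
exists (\sum_(j < d) (a j)%:Z * \sum_(i < j.+1) (n + m) ^+ (j.+1.-1 - i) * n ^+ i).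
rewrite /int_poly mulr_sumr -big_split/=; apply: eq_bigr => j _.
have := subrXX (n + m) n j.+1; rewrite (_ : n + m - n = m); last by ring.
move=> /(congr1 (fun z => z + n ^+ j.+1)); rewrite subrK => ->; ring.
Qed.

(** Linear terms cancel, the quadratic one gives exactly [2 * a j1 * u * t], and the higher
    coefficients are multiples of 3. *)
Lemma int_poly_mixed_difference d (a : 'I_d -> nat) (j1 : 'I_d) (n u t : int) :
  j1 = 1%N :> nat -> (forall j : 'I_d, (1 < j)%N -> (3 %| a j)%N) ->
  exists w, int_poly a (n + u + t) + int_poly a n =
    int_poly a (n + u) + int_poly a (n + t) + u * t * (2 * (a j1)%:Z + 3 * w).
Proof.
move=> hj1 ha.
have /choice[w hw] (j : 'I_d) : exists w, (a j)%:Z * (n + u + t) ^+ j.+1 + (a j)%:Z * n ^+ j.+1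
    = (a j)%:Z * (n + u) ^+ j.+1 + (a j)%:Z * (n + t) ^+ j.+1
      + u * t * ((if j == j1 then 2 * (a j)%:Z else 0) + 3 * w).
  case: (ltngtP j 1) => j1'.
  - exists 0; move: j1'; rewrite ltnS leqn0 => /eqP j0; rewrite j0 ifF; last first.
      by apply/eqP => /(congr1 val)/=; rewrite j0 hj1.
    by rewrite !expr1; ring.
  - rewrite ifF; last by apply/eqP => jj; move: j1'; rewrite jj hj1.
    have [w e] := exp_mixed_difference n u t j.+1.
    have /dvdnP[b hb] := ha j j1'.
    exists (b%:Z * w); rewrite -!mulrDr e hb PoszM; ring.
  - exists 0; rewrite ifT; last by apply/eqP/val_inj; rewrite /= hj1.
    by rewrite j1'; ring.
exists (\sum_j w j); rewrite /int_poly -!big_split/=.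
rewrite mulr_sumr [2 * _](_ : _ = \sum_j if j == j1 then 2 * (a j)%:Z else 0).
  by rewrite -big_split/= mulr_sumr -big_split/=; apply: eq_bigr => j _; rewrite hw.
by rewrite -big_mkcond/= big_pred1_eq.
Qed.

Context {R : realType}.
Local Notation e := (@cexp2pi R).

Lemma cexp2pi_frac_neq1 (b c : nat) : (0 < b)%N -> ~~ (b %| c)%N -> e (c%:R / b%:R) != 1.
Proof.
move=> b0 bc; rewrite (divn_eq c b) natrD mulrDl natrM mulfK ?pnatr_eq0 -?lt0n//.
rewrite cexp2piD cexp2pi_nat mul1r; apply: cexp2pi_neq1.
rewrite divr_gt0 ?ltr0n ?[(0 < c %% b)%N]lt0n//=.
by rewrite ltr_pdivrMr ?ltr0n// mul1r ltr_nat ltn_mod.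
Qed.

(** The squared modulus is the sum over [u] of the correlations of [F] with its shift by [u]. For 0
    < u < q a translation of [n] multiplies the correlation by a nontrivial cube root of unity, so
    it is zero; [u = 0] contributes [q]. *)
Lemma norm_gauss_sum d (a : 'I_d -> nat) (j1 : 'I_d) (k : nat) :
  j1 = 1%N :> nat -> ~~ (3 %| a j1)%N ->
  (forall j : 'I_d, (1 < j)%N -> (3 %| a j)%N) ->
  `|\sum_(n < 3 ^ k) e ((int_poly a n)%:~R / (3 ^ k)%:R)| ^+ 2 = (3 ^ k)%:R :> R[i].
Proof.
move=> hj1 ha1 ha; set q := (3 ^ k)%N.
have q0 : (0 < q)%N by rewrite expn_gt0.
have q0R : q%:R != 0 :> R by rewrite pnatr_eq0 -lt0n.
pose F (n : nat) := e ((int_poly a n)%:~R / q%:R).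
have Fq n : F (n + q)%N = F n.
  rewrite /F PoszD; have [w ->] := int_poly_period a n q.
  by rewrite rmorphD rmorphM/= mulrDl cexp2piD [q%:~R * _]mulrC mulfK// cexp2pi_int mulr1.
pose K u n := F (n + u)%N * (F n)^*.
have Kq u n : K u (n + q)%N = K u n by rewrite /K addnAC !Fq.
have K0 u : (0 < u < q)%N -> \sum_(n < q) K u n = 0.
  move=> /andP[u0 uq]; have [u' cu' hu'] := pfactor_coprime (isT : prime 3) u0.
  set i := logn 3 u in hu'.
  have ik : (i < k)%N.
    rewrite -(@ltn_exp2l 3)//; apply: leq_ltn_trans uq.
    by rewrite hu' leq_pmull// lt0n; apply/eqP => z; rewrite z in cu'.
  (* Shifting by [t] multiplies the summand [K u] by the constant [om <> 1]. *)
  pose t := (3 ^ (k - i.+1))%N.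
  (* Since [u = u' * 3 ^ i] with [u'] prime to 3, [u * t / q] is [u' / 3], and the phase grows by
     [2 * a j1 * u' / 3] modulo 1. *)
  have ut : (u * t * 3 = u' * q)%N.
    by rewrite hu' -!mulnA; congr muln; rewrite /t -expnSr -expnD; congr expn; lia.
  pose om := e ((2 * a j1 * u')%:R / 3%:R).
  have om1 : om != 1.
    apply: cexp2pi_frac_neq1 => //; rewrite !Euclid_dvdM// -[(3 %| u')%N]negbK.
    by rewrite -prime_coprime// cu'/= orbF.
  have Kt n : K u (n + t)%N = K u n * om.
    rewrite /K /F -!cexp2piN -!cexp2piD /om.
    have [w hw] := int_poly_mixed_difference n u t hj1 ha.
    rewrite (addnAC n t u) !PoszD -!mulNr -!mulrDl -!rmorphN -!rmorphD/=.
    have -> : int_poly a (n%:Z + u + t) - int_poly a (n%:Z + t) =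
        int_poly a (n%:Z + u) - int_poly a n%:Z + (u * t)%:Z * (2 * (a j1)%:Z + 3 * w).
      by rewrite PoszM; lia.
    rewrite rmorphD mulrDl !cexp2piD; congr (_ * _).
    have -> : (((u * t)%N%:Z * (2 * (a j1)%:Z + 3 * w))%:~R / q%:R : R) =
        (2 * a j1 * u')%:R / 3%:R + (u'%:Z * w)%:~R.
      have e3 : ((u * t)%N%:R = u'%:R * q%:R / 3%:R :> R).
        by rewrite -natrM -ut [in RHS]natrM mulfK ?pnatr_eq0.
      rewrite !rmorphM rmorphD !rmorphM/= -!pmulrn.
      by rewrite -(natrM _ u t) e3 !natrM; field.
    by rewrite cexp2piD cexp2pi_int mulr1.
  have := sum_periodic_shift t (Kq u).
  under eq_bigr do rewrite Kt.
  rewrite -mulr_suml => /eqP; rewrite -subr_eq0 -[X in _ - X]mulr1 -mulrBr mulf_eq0 subr_eq0.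
  by rewrite (negbTE om1) orbF => /eqP.
change (`|\sum_(n < q) F n| ^+ 2 = q%:R :> R[i]).
rewrite sqr_normc -[X in _ * X]/((\sum_(n < q) F n)^*) rmorph_sum/= mulr_sumr.
transitivity (\sum_(m < q) \sum_(u < q) K u m).
  apply: eq_bigr => m _; rewrite -(sum_periodic_shift m Fq) mulr_suml.
  by apply: eq_bigr => u _; rewrite /K addnC.
rewrite exchange_big/= (bigD1 (Ordinal q0))//= [X in _ + X]big1 ?addr0; last first.
  move=> u u0; apply: K0.
  by rewrite ltn_ord andbT lt0n; apply: contra u0 => /eqP z; exact/eqP/val_inj.
rewrite /K; under eq_bigr do rewrite addn0 mulcJ_cexp2pi.
by rewrite sumr_const card_ord.
Qed.

End GaussSum.

(** * Weyl sums and integrals over boxes *)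

Section WeylSum.
Context {R : realType}.
Implicit Types (d N : nat).
Local Notation e := (@cexp2pi R).

Lemma norm_weyl_sumB d (x y : d.-tuple R) N (b : R) :
  (forall j : 'I_d, `|tnth x j - tnth y j| * N%:R ^+ j.+1 <= b) ->
  `|weyl_sum x N - weyl_sum y N| <= (4 * pi * (d%:R * b) * N%:R)%:C.
Proof.
move=> xyb; rewrite /weyl_sum -sumrB.
apply: (le_trans (ler_norm_sum _ _ _)).
have -> : (4 * pi * (d%:R * b) * N%:R)%:C = \sum_(1 <= n < N.+1) (4 * pi * (d%:R * b))%:C.
  by rewrite sumr_const_nat subn1/= -rmorphMn/= mulr_natr.
rewrite big_nat [leRHS]big_nat; apply: ler_sum => n /andP[n1 nN].
apply: (le_trans (norm_cexp2piB _ _)); rewrite lecR ler_wpM2l ?mulr_ge0 ?pi_ge0//.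
rewrite -sumrB; apply: (le_trans (ler_norm_sum _ _ _)).
have -> : d%:R * b = \sum_(j < d) b by rewrite sumr_const card_ord mulr_natl.
apply: ler_sum => j _.
rewrite -mulrBl normrM; apply: le_trans (xyb j).
by rewrite ler_wpM2l// ger0_norm ?exprn_ge0// lerXn2r ?nnegrE// ler_nat.
Qed.

Lemma norm_weyl_sum_le d (x : d.-tuple R) N : `|weyl_sum x N| <= (N%:R)%:C.
Proof.
apply: (le_trans (ler_norm_sum _ _ _)).
under eq_bigr do rewrite norm_cexp2pi.
by rewrite sumr_const_nat subn1 rmorph_nat.
Qed.

Lemma measurable_normc_weyl_sum d N :
  measurable_fun setT (fun x : d.-tuple R => Normc.normc (weyl_sum x N)).
Proof.
pose ph (x : d.-tuple R) n := 2 * pi * \sum_(j < d) tnth x j * n%:R ^+ j.+1.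
have -> : (fun x : d.-tuple R => Normc.normc (weyl_sum x N)) =
    (fun x => Num.sqrt ((\sum_(1 <= n < N.+1) cos (ph x n)) ^+ 2
                      + (\sum_(1 <= n < N.+1) sin (ph x n)) ^+ 2)).
  apply/funext => x; rewrite (_ : weyl_sum x N =
    (\sum_(1 <= n < N.+1) cos (ph x n)) +i* (\sum_(1 <= n < N.+1) sin (ph x n)))//.
  rewrite /weyl_sum; elim/big_ind3 : _ => //.
  by move=> z1 a1 b1 z2 a2 b2 -> ->.
have mph n : measurable_fun setT (fun x : d.-tuple R => ph x n).
  apply: measurable_funM => //; apply: measurable_sum => j.
  by apply: measurable_funM => //; exact: measurable_tnth.
have msqrt : measurable_fun setT (@Num.sqrt R).
  by apply: continuous_measurable_fun; exact: sqrt_continuous.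
have mcos : measurable_fun setT (@cos R).
  by apply: continuous_measurable_fun; exact: continuous_cos.
have msin : measurable_fun setT (@sin R).
  by apply: continuous_measurable_fun; exact: continuous_sin.
apply: (measurableT_comp msqrt).
apply: measurable_funD; apply: measurable_funX; apply: measurable_sum => n.
  exact: (measurableT_comp mcos).
exact: (measurableT_comp msin).
Qed.

(** Half-open, so that neighbouring grid cells are disjoint, and with one side length per
    coordinate. *)
Definition box d (P : d.-tuple R) (l : 'I_d -> R) : set (d.-tuple R) :=
  [set x | forall j, tnth P j <= tnth x j < tnth P j + l j].

Lemma measurable_tuple_rect d (A : 'I_d -> set R) : (forall j, measurable (A j)) ->
  measurable [set x : d.-tuple R | forall j, A j (tnth x j)].
Proof.
move=> mA; rewrite (_ : [set x | _] =
    \bigcap_(j : 'I_d) ((@tnth d R ^~ j) @^-1` A j)); last first.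
  by apply/seteqP; split => x /= xA j; [move=> _|]; apply: xA.
apply: fin_bigcap_measurable => // j _.
by rewrite -[X in measurable X]setTI; apply: measurable_tnth.
Qed.

Lemma boxE d (P : d.-tuple R) l :
  box P l = [set x | forall j, `[tnth P j, tnth P j + l j[%classic (tnth x j)].
Proof. by apply/seteqP; split => x /= h j; have := h j; rewrite /= in_itv. Qed.

Lemma measurable_box d (P : d.-tuple R) l : measurable (box P l).
Proof.
rewrite boxE.
exact: (measurable_tuple_rect (A := fun j => `[tnth P j, tnth P j + l j[%classic)).
Qed.

Lemma lebesgue_box d (P : d.-tuple R) l : (forall j, 0 <= l j) ->
  lebesgue_tuple R d (box P l) = (\prod_(j < d) l j)%:E.
Proof.
move=> l0; rewrite boxE (lebesgue_tupleX (A := fun j => `[tnth P j, tnth P j + l j[%classic))//.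
rewrite -prodEFin; apply: eq_bigr => j _.
rewrite lebesgue_measure_itv/= lte_fin; case: ltP => [_|].
  by rewrite -EFinD addrAC subrr add0r.
by rewrite gerDl => lj; congr EFin; apply/eqP; rewrite eq_le l0 lj.
Qed.

Lemma measurable_cube d (delta : R) (xi : d.-tuple R) : measurable (cube delta xi).
Proof.
rewrite (_ : cube delta xi = [set x | forall j,
    `[tnth xi j, tnth xi j + delta]%classic (tnth x j)]).
  exact: (measurable_tuple_rect (A := fun j => `[tnth xi j, tnth xi j + delta]%classic)).
by apply/seteqP; split => x /= h j; have := h j; rewrite /= in_itv.
Qed.

(** The nonnegative integrand is restricted to disjoint translates of one box and minorised by a
    constant on each. It serves both a grid of many cells and, with [I := unit], a single box. *)
Lemma mean_value_ge (I : finType) d (s delta : R) (xi : d.-tuple R) N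
    (P : I -> d.-tuple R) (l : 'I_d -> R) (v : I -> R) :
  (forall j, 0 <= l j) -> (forall i, 0 <= v i) ->
  (forall i, box (P i) l `<=` cube delta xi) ->
  trivIset setT (fun i => box (P i) l) ->
  (forall i x, box (P i) l x -> v i <= Normc.normc (weyl_sum x N) `^ (2 * s)) ->
  ((\sum_i v i * \prod_j l j)%:E <= mean_value s delta xi N)%E.
Proof.
move=> l0 v0 Pc tP vS; rewrite /mean_value.
set f := fun x : d.-tuple R => _.
have mf (D : set (d.-tuple R)) : measurable_fun D f.
  apply: measurable_funTS; apply/measurable_EFinP.
  apply: (measurableT_comp (measurable_powR (2 * s))).
  exact: measurable_normc_weyl_sum.
have f0 x : (0 <= f x)%E by rewrite lee_fin powR_ge0.
pose D := \big[setU/set0]_(i <- index_enum I) box (P i) l.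
have mD : measurable D by apply: bigsetU_measurable => i _; exact: measurable_box.
have DC : D `<=` cube delta xi.
  by rewrite /D; elim/big_ind : _ => // A B AC BC x [/AC|/BC].
apply: (@le_trans _ _ (\int[lebesgue_tuple R d]_(x in D) f x)%E); last first.
  by apply: ge0_subset_integral => //; exact: measurable_cube.
rewrite ge0_integral_bigsetU//; last 3 first.
- by move=> i; exact: measurable_box.
- exact: index_enum_uniq.
- by apply: sub_trivIset tP.
rewrite -sumEFin; apply: lee_sum => i _.
rewrite EFinM -(@lebesgue_box _ (P i))// -integral_cst; last exact: measurable_box.
apply: ge0_le_integral => //; first exact: measurable_box.
  by move=> x _; rewrite lee_fin v0.
by move=> x Px; rewrite lee_fin; apply: vS Px.
Qed.

End WeylSum.

(** * Mean square over a grid *)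

Section MeanSquare.
Context {R : realType}.
Implicit Types (d N : nat).
Local Notation e := (@cexp2pi R).

Lemma ler_sum_injective (F : numDomainType) (I J : finType) (P : pred I) (f : I -> J)
    (g : J -> F) :
  {in P &, injective f} -> (forall j, 0 <= g j) ->
  \sum_(i | P i) g (f i) <= \sum_j g j.
Proof.
move=> finj g0; pose A := [set i | P i]%SET.
have -> : \sum_(i | P i) g (f i) = \sum_(j in f @: A) g j.
  rewrite big_imset/=; last by move=> i i'; rewrite !inE; exact: finj.
  by apply: eq_bigl => i; rewrite inE.
rewrite [leRHS](bigID (mem (f @: A)))/= lerDl; exact: sumr_ge0.
Qed.

(** Conjugation reduces to [j < i]; the sum is then geometric, and its ratio is a [q]-th root of
    unity other than 1. *)
Lemma sum_cexp2pi_frac (q i j : nat) : (i < q)%N -> (j < q)%N -> i != j ->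
  \sum_(v < q) e ((i%:R - j%:R) * (v%:R / q%:R)) = 0.
Proof.
wlog ji : i j / (j < i)%N.
  move=> H iq jq ij; have [/H|ij'|/eqP] := ltngtP i j; last by rewrite (negbTE ij).
    move=> /(_ jq iq); rewrite eq_sym => /(_ ij) h; apply: (can_inj (@conjCK R[i])).
    rewrite rmorph0 -[RHS]h rmorph_sum; apply: eq_bigr => v _.
    by rewrite -[LHS]/((e _)^*) -cexp2piN -mulNr opprB.
  exact: H.
move=> iq _ _; rewrite -natrB; last exact: ltnW.
set om := e ((i - j)%:R / q%:R).
have om1 : om != 1.
  by apply: cexp2pi_frac_neq1; [exact: leq_trans iq|rewrite gtnNdvd; lia].
have q0 : q%:R != 0 :> R by rewrite pnatr_eq0; lia.
under eq_bigr => v _ do rewrite mulrA mulrAC cexp2piM.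
have := subrX1 om q; rewrite -cexp2piM divfK// cexp2pi_nat subrr => /esym/eqP.
by rewrite mulf_eq0 subr_eq0 (negbTE om1) => /eqP.
Qed.

(** Its squared modulus is an unnormalised Fejer kernel. *)
Definition dirichlet (H : nat) (t : R) : R[i] := \sum_(i < H) e (i%:R * t).

Lemma dirichlet0 H : dirichlet H 0 = H%:R.
Proof.
rewrite /dirichlet; under eq_bigr do rewrite mulr0 cexp2pi0.
by rewrite sumr_const card_ord.
Qed.

Lemma norm_dirichlet_le H t : `|dirichlet H t| <= H%:R.
Proof.
apply: (le_trans (ler_norm_sum _ _ _)); under eq_bigr do rewrite norm_cexp2pi.
by rewrite sumr_const card_ord.
Qed.

(** Parseval modulo [q]: the [H <= q] frequencies are distinct modulo [q], and the translation by
    [b] only changes phases. *)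
Lemma sum_sqr_dirichlet (q H : nat) (b : R) : (H <= q)%N ->
  \sum_(v < q) `|dirichlet H (v%:R / q%:R + b)| ^+ 2 = (q * H)%:R.
Proof.
move=> Hq.
transitivity (\sum_(v < q) \sum_(i < H) \sum_(j < H)
    e ((i%:R - j%:R) * b) * e ((i%:R - j%:R) * (v%:R / q%:R))).
  apply: eq_bigr => v _; rewrite sqr_normc -[X in _ * X]/((dirichlet H _)^*).
  rewrite /dirichlet mulr_suml; apply: eq_bigr => i _.
  rewrite rmorph_sum mulr_sumr; apply: eq_bigr => j _.
  by rewrite -[X in _ * X]/((e _)^*) -cexp2piN -!cexp2piD; congr (e _); ring.
rewrite exchange_big/=.
transitivity (\sum_(i < H) (q%:R : R[i])); last first.
  by rewrite sumr_const card_ord mulnC natrM mulr_natl.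
apply: eq_bigr => i _; rewrite exchange_big (bigD1 i)//= [X in _ + X]big1 => [|j ji].
  rewrite addr0; under eq_bigr do rewrite subrr !mul0r cexp2pi0 mulr1.
  by rewrite sumr_const card_ord.
rewrite -mulr_sumr sum_cexp2pi_frac ?mulr0//.
- exact: leq_trans Hq.
- exact: leq_trans Hq.
- by rewrite eq_sym.
Qed.

Definition grid_point d (xi : d.-tuple R) (q : nat) (a : 'I_d -> nat) : d.-tuple R :=
  [tuple tnth xi j + (a j)%:R / q%:R | j < d].

Lemma weyl_sumE d (x : d.-tuple R) N :
  weyl_sum x N = \sum_(n < N) \prod_(j < d) e (tnth x j * n.+1%:R ^+ j.+1).
Proof.
rewrite /weyl_sum big_add1/= big_mkord; apply: eq_bigr => n _.
by elim/big_ind2 : _ => [|t z u w <- <-|//]; rewrite ?cexp2pi0 ?cexp2piD.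
Qed.

(** The index [n : 'I_N] stands for the summation variable [n.+1], whence the successors. *)
Definition power_diff (n m j : nat) : R := n.+1%:R ^+ j - m.+1%:R ^+ j.

(* The pair (n - m, n^2 - m^2) determines (n, m) off the diagonal. *)
Lemma sum_dirichlet_offdiag (q H N : nat) : (2 * N ^ 2 < q)%N -> (H <= q)%N ->
  \sum_(p : 'I_N * 'I_N | p.1 != p.2)
    `|dirichlet H (power_diff p.1 p.2 1 / q%:R)| ^+ 2 *
    `|dirichlet H (power_diff p.1 p.2 2 / q%:R)| ^+ 2 <= ((q * H) ^ 2)%:R.
Proof.
move=> Nq Hq; case: q Nq Hq => // q Nq Hq.
(* The differences are made natural numbers by adding [N] and [N ^ 2]; [b1] and [b2] undo this. Both
   then lie below [q] because 2 N^2 < q, so they can serve as residues. *)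
pose F b (v : nat) := `|dirichlet H (v%:R / q.+1%:R + b)| ^+ 2.
pose b1 : R := - (N%:R / q.+1%:R); pose b2 : R := - ((N ^ 2)%:R / q.+1%:R).
pose u (p : 'I_N * 'I_N) := (p.1 + N - p.2)%N.
pose v (p : 'I_N * 'I_N) := (p.1.+1 ^ 2 + N ^ 2 - p.2.+1 ^ 2)%N.
have uq p : (u p < q.+1)%N.
  rewrite /u; have p1N := ltn_ord p.1.
  have : (N <= N ^ 2)%N by rewrite expnS expn1 leq_pmulr//; lia.
  by lia.
have sqN (n : 'I_N) : (n.+1 ^ 2 <= N ^ 2)%N by rewrite leq_exp2r.
have vq p : (v p < q.+1)%N.
  by apply: leq_ltn_trans Nq; rewrite /v; have := sqN p.1; lia.
have -> : ((q.+1 * H) ^ 2)%:R = \sum_(y : 'I_q.+1 * 'I_q.+1) F b1 y.1 * F b2 y.2.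
  rewrite -(pair_bigA _ (fun y z => F b1 (y : 'I__) * F b2 (z : 'I__)))/=.
  under eq_bigr do rewrite -mulr_sumr sum_sqr_dirichlet//.
  by rewrite -mulr_suml sum_sqr_dirichlet// natrX expr2.
under eq_bigr => p _.
  have -> : power_diff p.1 p.2 1 / q.+1%:R = (inord (u p) : 'I_q.+1)%:R / q.+1%:R + b1.
    rewrite /b1 -mulrBl inordK// /u natrB; last first.
      exact: leq_trans (ltnW (ltn_ord p.2)) (leq_addl _ _).
    by rewrite /power_diff !expr1 natrD -!natr1; congr (_ / _); ring.
  have -> : power_diff p.1 p.2 2 / q.+1%:R = (inord (v p) : 'I_q.+1)%:R / q.+1%:R + b2.
    rewrite /b2 -mulrBl inordK// /v natrB; last by rewrite (leq_trans (sqN p.2))// leq_addl.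
    by rewrite /power_diff natrD !natrX; congr (_ / _); ring.
  over.
pose g (y : 'I_q.+1 * 'I_q.+1) := F b1 y.1 * F b2 y.2.
apply: (@ler_sum_injective _ _ _ _ (fun p => (inord (u p), inord (v p))) g); last first.
  by move=> y; rewrite mulr_ge0 ?exprn_ge0.
move=> -[n m] [n' m']; rewrite /in_mem/= => nm nm' [].
move=> /(congr1 val)/=; rewrite !inordK// => uu /(congr1 val)/=; rewrite !inordK// => vv.
move: uu vv nm nm'; rewrite /u /v/= -!(inj_eq val_inj)/= => uu vv nm nm'.
have hn := ltn_ord n; have hm := ltn_ord m; have hn' := ltn_ord n'; have hm' := ltn_ord m'.
suff [h1 h2] : n = n' :> nat /\ m = m' :> nat by congr (_, _); exact: val_inj.
have h : (n + m' = n' + m)%N by lia.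
have {vv}vv : (n.+1 ^ 2 + m'.+1 ^ 2 = n'.+1 ^ 2 + m.+1 ^ 2)%N.
  by have := sqN m; have := sqN m'; lia.
(* The differences agree and are nonzero, so dividing the differences of squares by them shows that
   the sums agree too. *)
nia.
Qed.

(** After expanding the square, the sum over [i] and [i'] factors over coordinates into Fejer
    kernels. Adding [H] keeps [i j - i' j] nonnegative. *)
Lemma sum_sqr_weyl_sum_translates d (xi : d.-tuple R) (q H N : nat) :
  \sum_(i : {ffun 'I_d -> 'I_H}) \sum_(i' : {ffun 'I_d -> 'I_H})
     `|weyl_sum (grid_point xi q (fun j => (H + i j - i' j)%N)) N| ^+ 2 =
  \sum_(p : 'I_N * 'I_N)
    (\prod_(j < d) e ((tnth xi j + H%:R / q%:R) * power_diff p.1 p.2 j.+1)) *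
     \prod_(j < d) `|dirichlet H (power_diff p.1 p.2 j.+1 / q%:R)| ^+ 2.
Proof.
pose A (p : 'I_N * 'I_N) (j : 'I_d) (i : 'I_H) := e (i%:R * (power_diff p.1 p.2 j.+1 / q%:R)).
pose z (p : 'I_N * 'I_N) := \prod_(j < d) e ((tnth xi j + H%:R / q%:R) * power_diff p.1 p.2 j.+1).
transitivity (\sum_(i : {ffun 'I_d -> 'I_H}) \sum_(i' : {ffun 'I_d -> 'I_H})
  \sum_(p : 'I_N * 'I_N) z p * ((\prod_j A p j (i j)) * \prod_j (A p j (i' j))^*)).
  apply: eq_bigr => i _; apply: eq_bigr => i' _.
  rewrite sqr_normc -[X in _ * X]/((weyl_sum _ _)^*) weyl_sumE mulr_suml.
  rewrite -(pair_bigA _ (fun n m => z (n, m) *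
    ((\prod_j A (n, m) j (i j)) * \prod_j (A (n, m) j (i' j))^*)))/=.
  apply: eq_bigr => n _; rewrite rmorph_sum mulr_sumr; apply: eq_bigr => m _.
  rewrite rmorph_prod /z -!big_split/=; apply: eq_bigr => j _.
  rewrite /A -!cexp2piN -!cexp2piD tnth_mktuple natrB; last first.
    exact: leq_trans (ltnW (ltn_ord (i' j))) (leq_addr _ _).
  by congr (e _); rewrite natrD /power_diff/=; ring.
transitivity (\sum_(p : 'I_N * 'I_N) \sum_(i : {ffun 'I_d -> 'I_H}) \sum_(i' : {ffun 'I_d -> 'I_H})
  z p * ((\prod_j A p j (i j)) * \prod_j (A p j (i' j))^*)).
  by rewrite [RHS]exchange_big/=; apply: eq_bigr => i _; rewrite [RHS]exchange_big.
apply: eq_bigr => p _.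
under eq_bigr do rewrite -mulr_sumr -mulr_sumr.
rewrite -mulr_sumr -mulr_suml; congr (_ * _).
rewrite -(bigA_distr_bigA (fun j i => A p j i)) -(bigA_distr_bigA (fun j i => (A p j i)^*)).
by rewrite -big_split/=; apply: eq_bigr => j _; rewrite sqr_normc -rmorph_sum.
Qed.

(** The Fejer-weighted sum [T] is at most [H ^ d] times the plain grid sum, and differs from its
    diagonal part by an off-diagonal error. *)
Lemma grid_mean_square d (j0 j1 : 'I_d) (xi : d.-tuple R) (q H N : nat) :
  j0 = 0%N :> nat -> j1 = 1%N :> nat -> (2 * N ^ 2 < q)%N -> (H <= q)%N ->
  N%:R * (H%:R ^+ 2) ^+ d <= H%:R ^+ d *
    (\sum_(a : {ffun 'I_d -> 'I_(H + H)})
      Normc.normc (weyl_sum (grid_point xi q (fun j => a j)) N) ^+ 2)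
    + (H%:R ^+ 2) ^+ d.-1 * q%:R ^+ 2.
Proof.
move=> hj0 hj1 Nq Hq; rewrite -lecR rmorphD !rmorphM !rmorphXn !rmorph_nat rmorph_sum/=.
under [X in _ * X + _]eq_bigr do rewrite rmorphXn/= -normcE_complex.
set G := fun a : 'I_d -> nat => `|weyl_sum (grid_point xi q a) N| ^+ 2.
pose T := \sum_(i : {ffun 'I_d -> 'I_H}) \sum_(i' : {ffun 'I_d -> 'I_H})
     G (fun j => (H + i j - i' j)%N).
(* For fixed [i'] the map from [i] to [H + i - i'] is injective into the grid, and there are [H ^ d]
   choices of [i']. *)
have TG : T <= H%:R ^+ d * \sum_(a : {ffun 'I_d -> 'I_(H + H)}) G (fun j => a j).
  have [H0|H0] := posnP H.
    rewrite /T big1 => [|i _].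
      by apply: mulr_ge0; rewrite ?exprn_ge0//; apply: sumr_ge0 => a _; exact: exprn_ge0.
    by have /lt0n_neq0/eqP[] := leq_ltn_trans (leq0n _) (ltn_ord (i j0)).
  rewrite /T exchange_big/=.
  have -> : H%:R ^+ d * \sum_(a : {ffun 'I_d -> 'I_(H + H)}) G (fun j => a j) =
      \sum_(i' : {ffun 'I_d -> 'I_H}) \sum_(a : {ffun 'I_d -> 'I_(H + H)}) G (fun j => a j).
    by rewrite sumr_const card_ffun !card_ord -[RHS]mulr_natl natrX.
  apply: ler_sum => i' _.
  have lt2 (i : {ffun 'I_d -> 'I_H}) j : (H + i j - i' j < (H + H).-1.+1)%N.
    by have := ltn_ord (i j); lia.
  have HH : (H + H).-1.+1 = (H + H)%N by lia.
  pose sh (i : {ffun 'I_d -> 'I_H}) : {ffun 'I_d -> 'I_(H + H)} :=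
    [ffun j => cast_ord HH (Ordinal (lt2 i j))].
  under eq_bigr => i _.
    rewrite (_ : G _ = G (fun j => sh i j)); last first.
      rewrite /G; congr (`|weyl_sum _ _| ^+ 2).
      by apply: eq_from_tnth => j; rewrite !tnth_mktuple ffunE.
    over.
  apply: (@ler_sum_injective _ _ _ _ sh (fun a => G (fun j => a j))) => [i1 i2 _ _ /ffunP hi|a].
    apply/ffunP => j; have := hi j; rewrite !ffunE => /(congr1 val)/= hh.
    by apply: val_inj => /=; have := ltn_ord (i' j); lia.
  by rewrite exprn_ge0.
apply: le_trans (lerD TG (lexx _)).
pose z (p : 'I_N * 'I_N) := \prod_(j < d) e ((tnth xi j + H%:R / q%:R) * power_diff p.1 p.2 j.+1).
pose K (p : 'I_N * 'I_N) (j : nat) := `|dirichlet H (power_diff p.1 p.2 j.+1 / q%:R)| ^+ 2.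
have TE : T = \sum_p z p * \prod_(j < d) K p j by exact: sum_sqr_weyl_sum_translates.
pose Off := \sum_(p : 'I_N * 'I_N | p.1 != p.2) z p * \prod_(j < d) K p j.
(* On the diagonal all phases are trivial and every kernel equals [H ^ 2]. *)
have TOff : N%:R * (H%:R ^+ 2) ^+ d = T - Off.
  rewrite TE (bigID (fun p : 'I_N * 'I_N => p.1 != p.2))/= addrAC subrr add0r.
  transitivity (\sum_(n < N) ((H%:R ^+ 2) ^+ d : R[i])).
    by rewrite sumr_const card_ord mulr_natl.
  rewrite (reindex_onto (fun n : 'I_N => (n, n)) fst)/=; last first.
    by move=> [n m]/=; rewrite negbK => /eqP ->.
  under [RHS]eq_bigl do rewrite !eqxx.
  apply: eq_bigr => n _; rewrite /z /K /power_diff/= big1 => [|j _]; last first.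
    by rewrite subrr mulr0 cexp2pi0.
  under eq_bigr do rewrite subrr mul0r dirichlet0 ger0_norm//.
  by rewrite prodr_const card_ord mul1r.
have T0 : 0 <= T by apply: sumr_ge0 => i _; apply: sumr_ge0 => i' _; rewrite exprn_ge0.
have -> : N%:R * (H%:R ^+ 2) ^+ d = `|N%:R * (H%:R ^+ 2) ^+ d| :> R[i].
  by rewrite ger0_norm// mulr_ge0 ?exprn_ge0.
rewrite TOff; apply: (le_trans (ler_normB _ _)); rewrite (ger0_norm T0) lerD2l.
apply: (le_trans (ler_norm_sum _ _ _)).
have j01 : j1 != j0 by rewrite -(inj_eq val_inj)/= hj0 hj1.
(* Only the kernels of the first two coordinates are kept; each of the other [d - 2] is bounded by
   [H ^ 2]. *)
apply: (@le_trans _ _ (\sum_(p : 'I_N * 'I_N | p.1 != p.2)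
    (H%:R ^+ 2) ^+ (d - 2) * (K p 0%N * K p 1%N))).
  apply: ler_sum => p _; rewrite normrM normr_prod.
  under eq_bigr do rewrite norm_cexp2pi.
  rewrite big1_eq mul1r normr_prod.
  under eq_bigr do rewrite ger0_norm ?exprn_ge0//.
  rewrite (bigD1 j0)//= (bigD1 j1)//= hj0 hj1 [leRHS]mulrC mulrA ler_wpM2l ?mulr_ge0 ?exprn_ge0//.
  apply: (@le_trans _ _ (\prod_(j < d | (j != j0) && (j != j1)) H%:R ^+ 2)).
    apply: ler_prod => j _; rewrite exprn_ge0//= lerXn2r ?nnegrE//.
    exact: norm_dirichlet_le.
  rewrite prodr_const (_ : #|_| = (d - 2)%N)//.
  have := cardsC [set j0; j1]%SET; rewrite cards2 eq_sym j01 card_ord => dE.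
  by rewrite -[in RHS]dE addKn; apply: eq_card => j; rewrite !inE negb_or.
rewrite -mulr_sumr.
have -> : ((H%:R ^+ 2) ^+ d.-1 * q%:R ^+ 2 : R[i]) = (H%:R ^+ 2) ^+ (d - 2) * ((q * H) ^ 2)%:R.
  have -> : d.-1 = (d - 2).+1 by have := ltn_ord j1; rewrite hj1; lia.
  by rewrite natrX natrM exprS; ring.
by rewrite ler_wpM2l ?exprn_ge0//; exact: sum_dirichlet_offdiag.
Qed.

End MeanSquare.

(** * From the mean square on a grid to the integral over the cube *)

Section MeanSquareToMeanValue.
Context {R : realType}.

Lemma pi_le4 : pi <= 4 :> R.
Proof. by have := @pihalf_lt2 R; lra. Qed.

Lemma normc_weyl_sumB d (x y : d.-tuple R) N (b : R) :
  (forall j : 'I_d, `|tnth x j - tnth y j| * N%:R ^+ j.+1 <= b) ->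
  `|Normc.normc (weyl_sum x N) - Normc.normc (weyl_sum y N)| <= 16 * d%:R * b * N%:R.
Proof.
move=> hb; have hb' := norm_weyl_sumB hb.
rewrite -lecR; apply: (@le_trans _ _ (4 * pi * (d%:R * b) * N%:R)%:C); last first.
  have [d0|d0] := posnP d.
    by rewrite d0 !(mul0r, mulr0).
  have b0 : 0 <= b by apply: le_trans (hb (Ordinal d0)); rewrite mulr_ge0 ?exprn_ge0.
  rewrite lecR ler_wpM2r// mulrA ler_wpM2r// ler_wpM2r//.
  by have := pi_le4; lra.
apply: le_trans hb'; rewrite normcE_complex lecR.
have tri (z w : R[i]) : Normc.normc z - Normc.normc w <= Normc.normc (z - w).
  by rewrite lerBlDr -lecR rmorphD/= -!normcE_complex -[X in `|X| <= _](subrK w) ler_normD.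
rewrite ler_norml tri andbT lerNl opprB.
by rewrite (le_trans (tri _ _))// -lecR -!normcE_complex distrC.
Qed.

Lemma trivIset_grid_box d (xi : d.-tuple R) (q M : nat) : (0 < q)%N ->
  trivIset setT (fun a : {ffun 'I_d -> 'I_M} =>
    box (grid_point xi q (fun j => a j)) (fun=> q%:R^-1)).
Proof.
move=> q0; apply/trivIsetP => a a' _ _ aa'; rewrite -subset0.
move=> x [xa xa']; move/negP : aa'; apply; apply/eqP/ffunP => j; apply/val_inj.
have q0R : 0 < q%:R^-1 :> R by rewrite invr_gt0 ltr0n.
have aux (b c : nat) : tnth xi j + b%:R / q%:R <= tnth x j ->
    tnth x j < tnth xi j + c%:R / q%:R + q%:R^-1 -> (b <= c)%N.
  move=> h1 h2; have := le_lt_trans h1 h2.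
  by rewrite -addrA ltrD2l -[X in _ + X]mul1r -mulrDl natr1 ltr_pM2r// ltr_nat.
have := xa j; have := xa' j; rewrite /box/= !tnth_mktuple => /andP[h1 h2] /andP[h3 h4].
by apply/eqP; rewrite eqn_leq (aux _ _ h3 h2) (aux _ _ h1 h4).
Qed.

(** The minorant [A * (t ^+ 2 - tau)] of [t ^ (2 s)] transfers the mean square, of order [N], to the
    exponent [2 * s]; the last hypothesis makes [tau] cost at most half of it. *)
Lemma mean_value_ge_mean_square d (s delta A tau : R) (xi : d.-tuple R) (N : nat) :
  (2 <= d)%N -> 0 < delta -> delta <= 1 -> 32 <= N%:R * delta ^+ 2 ->
  0 <= A -> (forall t, 0 <= t -> t <= N%:R -> A * (t ^+ 2 - tau) <= t `^ (2 * s)) ->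
  1 + tau <= N%:R / 2 ^+ d.+2 ->
  ((A * (N%:R / 4) * (delta / 4) ^+ d)%:E <= mean_value s delta xi N)%E.
Proof.
move=> d2 de0 de1 hN A0 hA htau.
have d0 : (0 < d)%N by exact: leq_trans d2.
have N0 : (0 < N)%N.
  by rewrite lt0n; apply/eqP => n0; move: hN; rewrite n0 mul0r; lra.
(* This mesh is so fine that [|S|] varies by at most 1 / (2 N) on a cell, hence [|S| ^ 2] loses at
   most 1, as [|S| <= N]. *)
have [q qE] : exists q, q = (32 * d * N ^ d.+2)%N by eexists.
have Nd0 : (0 < N ^ d.+2)%N by rewrite expn_gt0 N0.
have q0 : (0 < q)%N by rewrite qE; nia.
have q0R : 0 < q%:R :> R by rewrite ltr0n.
have N0R : 0 < N%:R :> R by rewrite ltr0n.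
have Nq : (2 * N ^ 2 < q)%N.
  have : (N ^ 2 <= N ^ d.+2)%N by rewrite leq_pexp2l.
  have : (0 < N ^ 2)%N by rewrite expn_gt0 N0.
  by rewrite qE => h1 h2; nia.
have qN : N%:R <= q%:R :> R.
  rewrite ler_nat qE; have : (N ^ 1 <= N ^ d.+2)%N by rewrite leq_pexp2l.
  by rewrite expn1; nia.
have dq : 4 <= delta * q%:R.
  have : N%:R * delta ^+ 2 <= q%:R * delta.
    apply: ler_pM => //; first by rewrite exprn_ge0// ltW.
    by rewrite expr2; apply: ler_piMl => //; exact: ltW.
  lra.
(* The grid has [2 * H] cells of side [1 / q] per coordinate, which fit into a side of length
   [delta]. *)
pose H := Num.truncn (delta * q%:R / 2).
have [HL HU] : (H%:R <= delta * q%:R / 2 /\ delta * q%:R / 2 < H.+1%:R).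
  have /truncn_itv/andP[] : 0 <= delta * q%:R / 2 by lra.
  by [].
rewrite -(natr1 H) in HU; clearbody H.
have Hq4 : delta / 4 <= H%:R / q%:R by rewrite ler_pdivlMr//; lra.
have H0R : 0 < H%:R :> R by lra.
have Hq : (H <= q)%N.
  rewrite -(ler_nat R); have : delta * q%:R <= q%:R by rewrite ler_piMl// ltW.
  lra.
pose j0 := Ordinal d0; pose j1 := Ordinal d2.
pose P (a : {ffun 'I_d -> 'I_(H + H)}) := grid_point xi q (fun j => a j).
pose M a := Normc.normc (weyl_sum (P a) N) ^+ 2.
pose l (j : 'I_d) := q%:R^-1 : R.
have l0 j : 0 <= l j by rewrite invr_ge0 ltW.
(* The 1 pays for the variation over the cell, and the maximum with 0 keeps the minorant
   nonnegative. *)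
pose v a := Num.max 0 (A * (M a - 1 - tau)).
apply: (@le_trans _ _ (\sum_a v a * \prod_j l j)%:E); last first.
  apply: (@mean_value_ge _ _ _ _ _ _ _ P) => //.
  - by move=> a; rewrite le_max lexx.
  - move=> a x /= xa j; have := xa j; rewrite tnth_mktuple => /andP[h1 h2].
    have h3 : ((a j)%:R + 1) / q%:R <= delta.
      rewrite ler_pdivrMr// natr1.
      have : (a j).+1%:R <= (H + H)%:R :> R by rewrite ler_nat.
      by rewrite natrD; lra.
    have h4 : 0 <= (a j)%:R / q%:R :> R by rewrite divr_ge0.
    move: h2 h3; rewrite /l mulrDl mul1r; lra.
  - exact: trivIset_grid_box.
  move=> a x xa; rewrite ge_max powR_ge0/=.
  apply: le_trans (hA _ (normc_ge0 _) _); last by rewrite -lecR -normcE_complex norm_weyl_sum_le.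
  rewrite ler_wpM2l// lerB//.
  set t := Normc.normc (weyl_sum x N); rewrite /M; set t0 := Normc.normc _.
  have tN : t <= N%:R by rewrite -lecR -normcE_complex norm_weyl_sum_le.
  have t0N : t0 <= N%:R by rewrite -lecR -normcE_complex norm_weyl_sum_le.
  have : `|t - t0| <= 16 * d%:R * (N%:R ^+ d / q%:R) * N%:R.
    apply: normc_weyl_sumB => j; rewrite mulrC; apply: ler_pM => //.
      by rewrite -!natrX ler_nat leq_pexp2l// ltn_ord.
    have := xa j; rewrite ler_norml => /andP[h1 h2].
    by move: h2; rewrite /l; move: (l0 j); rewrite /l; lra.
  have -> : 16 * d%:R * (N%:R ^+ d / q%:R) * N%:R = (2 * N%:R)^-1 :> R.
    rewrite qE 2!natrM natrX !exprS; field.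
    by rewrite !pnatr_eq0 expf_neq0 ?pnatr_eq0 -!lt0n ?N0 ?d0.
  rewrite ler_norml => /andP[h _].
  have [tt|tt] := leP t0 t.
    have : t0 ^+ 2 <= t ^+ 2 by rewrite lerXn2r ?nnegrE ?normc_ge0.
    lra.
  have : (t0 - t) * (t0 + t) <= (2 * N%:R)^-1 * (2 * N%:R).
    apply: ler_pM; [lra| |lra|lra].
    by rewrite addr_ge0 ?normc_ge0.
  rewrite mulVf ?mulf_neq0 ?pnatr_eq0 -?lt0n// -subr_sqr; lra.
rewrite lee_fin -mulr_suml prodr_const card_ord.
have hms := @grid_mean_square R d j0 j1 xi q H N erefl erefl Nq Hq.
rewrite -[X in _ <= _ * X + _]/(\sum_a M a) in hms.
have vM : A * (\sum_a M a - (H + H)%:R ^+ d * (1 + tau)) <= \sum_a v a.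
  apply: (@le_trans _ _ (\sum_a A * (M a - 1 - tau))); last first.
    by apply: ler_sum => a _; rewrite le_max lexx orbT.
  rewrite -mulr_sumr ler_wpM2l//.
  under [leRHS]eq_bigr do rewrite -addrA.
  rewrite big_split/= sumr_const card_ffun !card_ord -[X in _ <= _ + X]mulr_natl natrX -opprD mulrN.
  exact: lexx.
(* As [delta * q <= 4 * H] and 32 <= N delta^2, the off-diagonal error is at most half the
   diagonal. *)
have hM : H%:R ^+ d * (N%:R / 2) <= \sum_a M a.
  rewrite -(ler_pM2l (exprn_gt0 d H0R)).
  have : (H%:R ^+ 2) ^+ d.-1 * q%:R ^+ 2 <= H%:R ^+ d * H%:R ^+ d * (N%:R / 2) :> R.
    have -> : H%:R ^+ d * H%:R ^+ d = (H%:R ^+ 2) ^+ d.-1 * H%:R ^+ 2 :> R.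
      by rewrite -exprSr prednK// -exprM -exprD mul2n addnn.
    rewrite -mulrA ler_wpM2l ?exprn_ge0//.
    have h1 : (delta * q%:R) ^+ 2 <= (4 * H%:R) ^+ 2.
      by rewrite lerXn2r ?nnegrE; lra.
    have h2 : 32 * q%:R ^+ 2 <= N%:R * (delta * q%:R) ^+ 2.
      by rewrite exprMn [leRHS]mulrA ler_wpM2r ?exprn_ge0.
    have h3 : N%:R * (delta * q%:R) ^+ 2 <= N%:R * (4 * H%:R) ^+ 2 by rewrite ler_wpM2l.
    rewrite exprMn in h3; nra.
  move: hms; rewrite exprAC expr2 => hms h; lra.
have hH : (H + H)%:R ^+ d * (1 + tau) <= H%:R ^+ d * (N%:R / 4).
  rewrite addnn -mul2n natrM exprMn mulrAC [leRHS]mulrC ler_wpM2r ?exprn_ge0//.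
  have : 2 ^+ d * (1 + tau) <= 2 ^+ d * (N%:R / 2 ^+ d.+2) by rewrite ler_wpM2l ?exprn_ge0.
  rewrite !exprS (_ : 2 ^+ d * (N%:R / (2 * (2 * 2 ^+ d))) = N%:R / 4 :> R)//.
  by field; rewrite expf_neq0.
apply: (@le_trans _ _ (A * (H%:R ^+ d * (N%:R / 4)) * q%:R^-1 ^+ d)).
  have -> : A * (H%:R ^+ d * (N%:R / 4)) * q%:R^-1 ^+ d = A * (N%:R / 4) * (H%:R / q%:R) ^+ d.
    by rewrite exprMn; ring.
  rewrite ler_wpM2l ?mulr_ge0//.
  by rewrite lerXn2r ?nnegrE//; rewrite divr_ge0// ltW.
rewrite ler_wpM2r ?exprn_ge0 ?invr_ge0//; apply: le_trans vM.
by rewrite ler_wpM2l//; lra.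
Qed.

End MeanSquareToMeanValue.

(** * Large values near a rational point *)

Section RationalPoint.

Lemma sum_periodic_blocks (V : nmodType) (F : nat -> V) (q L : nat) :
  (forall n, F (n + q)%N = F n) -> \sum_(n < L * q) F n = (\sum_(n < q) F n) *+ L.
Proof.
move=> Fq; elim: L => [|L IH]; first by rewrite mul0n big_ord0.
rewrite mulSnr big_split_ord/= IH mulrSr; congr (_ + _); apply: eq_bigr => n _ /=.
by elim: (L) => [|l IHl]; rewrite ?add0n// mulSnr addnAC Fq.
Qed.

(** The range splits into [N %/ q] full periods and fewer than [q] remaining terms. *)
Lemma norm_periodic_sum (C : numDomainType) (F : nat -> C) (q N : nat) : (0 < q)%N ->
  (forall n, F (n + q)%N = F n) -> (forall n, `|F n| <= 1) ->
  `|\sum_(n < q) F n| *+ (N %/ q) <= `|\sum_(n < N) F n| + q%:R.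
Proof.
move=> q0 Fq F1; rewrite -normrMn -sum_periodic_blocks//.
rewrite [in leRHS](divn_eq N q) big_split_ord/=.
set A := \sum_(i < _) _; set B := \sum_(i < _) _.
have B1 : `|B| <= q%:R.
  apply: (le_trans (ler_norm_sum _ _ _)).
  apply: (@le_trans _ _ (\sum_(i < N %% q) 1)); first by apply: ler_sum => i _.
  by rewrite sumr_const card_ord ler_nat ltnW// ltn_mod.
apply: le_trans (lerD (lexx _) B1).
by rewrite -[X in `|X| <= _](addrK B) ler_normB.
Qed.

Context {R : realType}.
Local Notation e := (@cexp2pi R).

Lemma weyl_sum_rational d (a : 'I_d -> nat) (q N : nat) :
  weyl_sum [tuple (a j)%:R / q%:R | j < d] N =
  \sum_(n < N) e ((int_poly a n.+1)%:~R / q%:R).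
Proof.
rewrite /weyl_sum big_add1/= big_mkord; apply: eq_bigr => n _; congr e.
rewrite /int_poly rmorph_sum mulr_suml; apply: eq_bigr => j _ /=.
by rewrite tnth_mktuple rmorphM rmorphXn/= -!pmulrn mulrAC.
Qed.

(** Full periods contribute at least N / sqrt q - sqrt q, the remainder costs at most [q], and the
    total loss, at most [2 * q], is at most half of N / sqrt q by the size condition. *)
Lemma normc_weyl_sum_rational d (a : 'I_d -> nat) (j1 : 'I_d) (k N : nat) :
  let q := (3 ^ k)%N in
  j1 = 1%N :> nat -> ~~ (3 %| a j1)%N ->
  (forall j : 'I_d, (1 < j)%N -> (3 %| a j)%N) ->
  4 * q%:R * Num.sqrt q%:R <= N%:R :> R ->
  N%:R / (2 * Num.sqrt q%:R) <=
    Normc.normc (weyl_sum [tuple (a j)%:R / q%:R | j < d] N : R[i]).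
Proof.
move=> q hj1 ha1 ha hN.
have q0 : (0 < q)%N by rewrite expn_gt0.
have q1 : 1 <= q%:R :> R by rewrite ler1n.
pose F (n : nat) := e ((int_poly a n)%:~R / q%:R).
have Fq n : F (n + q)%N = F n.
  rewrite /F PoszD; have [w ->] := int_poly_period a n q.
  rewrite rmorphD rmorphM/= mulrDl cexp2piD [q%:~R * _]mulrC mulfK ?cexp2pi_int ?mulr1//.
  by rewrite -pmulrn pnatr_eq0 -lt0n.
rewrite weyl_sum_rational.
have qC : q%:R = (q%:R)%:C :> R[i] by rewrite rmorph_nat.
have G : `|\sum_(n < q) F n.+1| = (Num.sqrt q%:R)%:C.
  rewrite (_ : \sum_(n < q) F n.+1 = \sum_(n < q) F (n + 1)%N); last first.
    by apply: eq_bigr => n _; rewrite addn1.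
  rewrite sum_periodic_shift//.
  have := @norm_gauss_sum R d a j1 k hj1 ha1 ha.
  rewrite -/q -[X in `|X|]/(\sum_(n < q) F n) normcE_complex -rmorphXn qC => /complexI.
  by move=> <-; rewrite sqrtr_sqr ger0_norm// normc_ge0.
have := @norm_periodic_sum _ (fun n => F n.+1) q N q0.
have F1 n : `|F n| <= 1 by rewrite norm_cexp2pi.
move=> /(_ (fun n => Fq n.+1) (fun n => F1 n.+1)).
rewrite G qC -rmorphMn normcE_complex -rmorphD lecR.
set S := Normc.normc _; set r := Num.sqrt q%:R in hN *.
have rr : r * r = q%:R by rewrite -expr2 sqr_sqrtr.
have r1 : 1 <= r by rewrite -sqrtr1 ler_wsqrtr.
have rq : r <= q%:R by rewrite -rr ler_peMl// (le_trans ler01).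
have NL : N%:R <= (N %/ q)%:R * q%:R + q%:R :> R.
  by rewrite -natrM -natrD ler_nat [leqLHS](divn_eq N q) leq_add2l ltnW// ltn_mod.
rewrite -mulr_natl; set L : R := (N %/ q)%:R in NL * => h.
rewrite ler_pdivrMr; last by lra.
have : N%:R <= (L * r) * r + q%:R by rewrite -mulrA rr.
nra.
Qed.

(** On the box with corner [P] the sum changes by at most half of the lower bound N / (2 sqrt q) for
    its modulus at [P]; the constant 64 in [ka] is chosen for this. *)
Lemma mean_value_ge_rational d (s delta : R) (xi : d.-tuple R) (k N : nat) :
  let q := (3 ^ k)%N in
  (2 <= d)%N -> 0 <= s -> torus xi -> delta <= 1 -> 5 <= delta * q%:R ->
  4 * q%:R * Num.sqrt q%:R <= N%:R :> R ->
  (((N%:R / (4 * Num.sqrt q%:R)) `^ (2 * s) *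
    \prod_(j < d) ((64 * d%:R * Num.sqrt q%:R)^-1 / N%:R ^+ j.+1))%:E
   <= mean_value s delta xi N)%E.
Proof.
move=> q d2 s0 xiT de1 hq hN.
have d0R : 1 <= d%:R :> R by rewrite ler1n ltnW.
have q0 : (0 < q)%N by rewrite expn_gt0.
have q1 : 1 <= q%:R :> R by rewrite ler1n.
have q0R : 0 < q%:R :> R by rewrite ltr0n.
set r : R := Num.sqrt q%:R in hN *.
have r1 : 1 <= r by rewrite -sqrtr1 ler_wsqrtr.
have qN : q%:R <= N%:R :> R by nra.
have N0R : 0 < N%:R :> R by lra.
pose ka : R := (64 * d%:R * r)^-1.
have ka0 : 0 <= ka by rewrite invr_ge0; nra.
have ka1 : ka <= 1 by rewrite invf_le1; nra.
pose j1 : 'I_d := Ordinal d2.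
(* The next multiple of 3 above [tnth xi j * q], raised by 1 at [j1] to make it prime to 3. It
   overshoots by at most 4; one more step of [1 / q] holds the box, hence the 5 in the
   hypothesis. *)
pose a (j : 'I_d) := (3 * (Num.truncn (tnth xi j * q%:R / 3)).+1 + (j == j1))%N.
pose P : d.-tuple R := [tuple (a j)%:R / q%:R | j < d].
have aP j : tnth xi j * q%:R <= (a j)%:R /\ (a j)%:R <= tnth xi j * q%:R + 4.
  have /andP[xi0 _] := xiT j.
  have /truncn_itv/andP[] : 0 <= tnth xi j * q%:R / 3 by rewrite divr_ge0// mulr_ge0.
  rewrite /a natrD natrM -(natr1 (Num.truncn _)).
  have [b0 b1] : 0 <= (j == j1)%:R :> R /\ (j == j1)%:R <= 1 :> R.
    by case: (j == j1); rewrite ?ler01 ?lexx.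
  by lra.
pose l (j : 'I_d) := ka / N%:R ^+ j.+1.
have l0 j : 0 <= l j by rewrite divr_ge0 ?exprn_ge0// ltW.
have lq j : l j <= q%:R^-1.
  apply: (@le_trans _ _ (1 / N%:R)); last by rewrite div1r lef_pV2.
  apply: ler_pM => //.
  rewrite lef_pV2 ?posrE ?exprn_gt0//.
  by rewrite exprS ler_peMr ?exprn_ege1 ?(le_trans q1)// ltW.
have := @mean_value_ge R unit d s delta xi N (fun=> P) l
  (fun=> (N%:R / (4 * r)) `^ (2 * s)).
rewrite big_const cardE enumT unlock/= addr0; apply => //.
- by move=> _; exact: powR_ge0.
- move=> _ x /= xP j; have := xP j; rewrite tnth_mktuple => /andP[h1 h2].
  have [h3 h4] := aP j; have h5 := lq j.
  have h6 : tnth xi j <= (a j)%:R / q%:R by rewrite ler_pdivlMr.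
  have h7 : (a j)%:R / q%:R + q%:R^-1 <= tnth xi j + delta.
    by rewrite -[X in _ + X]mul1r -mulrDl ler_pdivrMr//; lra.
  by lra.
- by apply/trivIsetP => -[] [].
- move=> _ x xP; have v0 : 0 <= N%:R / (4 * r) by rewrite divr_ge0//; lra.
  apply: ge0_ler_powR; rewrite ?nnegrE ?normc_ge0//; first by rewrite mulr_ge0.
  have hd : `|Normc.normc (weyl_sum x N) - Normc.normc (weyl_sum P N)| <= 16 * d%:R * ka * N%:R.
    apply: normc_weyl_sumB => j; have := xP j => /andP[h1 h2].
    rewrite -ler_pdivlMr ?exprn_gt0// ler_norml; move: (l0 j) h2; rewrite /l; lra.
  have hP : N%:R / (2 * r) <= Normc.normc (weyl_sum P N).
    apply: (@normc_weyl_sum_rational d a j1 k N) => //.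
      by rewrite /a eqxx dvdn_addr ?dvdn_mulr.
    move=> j j2; rewrite /a (_ : j == j1 = false) ?addn0 ?dvdn_mulr//.
    by apply/eqP => jj; move: j2; rewrite jj.
  have e1 : N%:R / (2 * r) = 2 * (N%:R / (4 * r)) by field; lra.
  have e2 : 16 * d%:R * ka * N%:R = N%:R / (4 * r) by rewrite /ka; field; lra.
  move: hd hP; rewrite e1 e2 ler_norml => /andP[h _]; lra.
Qed.

End RationalPoint.

(** * Exponents *)

Section Exponents.
Context {R : realType}.
Implicit Types (x y s delta eps n : R) (d k : nat).

Lemma powR_gt0D x y s : 0 < x -> x `^ (y + s) = x `^ y * x `^ s.
Proof. by move=> x0; rewrite powRD// (gt_eqF x0) implybT. Qed.

(** The loss [N ^ (- eps)] absorbs any fixed constant, from x^(-1/eps) on. *)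
Lemma powRN_eventually_le eps x : 0 < eps -> 0 < x ->
  exists N0 : nat, forall N, (N0 <= N)%N -> N%:R `^ (- eps) <= x.
Proof.
move=> eps0 x0; exists (Num.truncn (x `^ (- eps^-1))).+1 => N NN.
have h : x `^ (- eps^-1) <= N%:R.
  have /truncn_itv/andP[_ /ltW h] := powR_ge0 x (- eps^-1).
  by apply: le_trans h _; rewrite ler_nat.
have : x^-1 <= N%:R `^ eps.
  have : (x `^ (- eps^-1)) `^ eps <= N%:R `^ eps.
    by apply: ge0_ler_powR; rewrite ?nnegrE ?powR_ge0// ltW.
  by rewrite -powRrM mulNr mulVf ?gt_eqF// powR_inv1// ltW.
rewrite powRN => h2; rewrite -(invrK x) lef_pV2// posrE ?invr_gt0//.
by apply: lt_le_trans h2; rewrite invr_gt0.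
Qed.

(** For [k = 1] the term 1 / (2 d - 1) is at most 1/3; for [k >= 2] the term 1 / (2 k) is at most
    1/4. *)
Lemma nu_gt0_le d k : (2 <= d)%N -> (1 <= k <= d)%N -> 0 < nu R d k /\ 3 * nu R d k <= 1.
Proof.
move=> d2 /andP[k1 kd].
have d2R : 2 <= d%:R :> R by rewrite ler_nat.
have k1R : 1 <= k%:R :> R by rewrite ler1n.
have kdR : k%:R <= d%:R :> R by rewrite ler_nat.
have p1 : 0 < 2 * k%:R :> R by lra.
have p2 : 0 < 2 * d%:R - k%:R :> R by lra.
split; first by rewrite lt_min !invr_gt0 p1 p2.
have [/eqP k1'|k2] := boolP (k == 1%N).
  apply: (@le_trans _ _ (3 * (2 * d%:R - k%:R)^-1)).
    by rewrite ler_pM2l// ge_min lexx orbT.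
  by rewrite ler_pdivrMr// k1'; lra.
have k2R : 2 <= k%:R :> R by rewrite ler_nat; lia.
apply: (@le_trans _ _ (3 * (2 * k%:R)^-1)); first by rewrite ler_pM2l// ge_min lexx.
by rewrite ler_pdivrMr//; lra.
Qed.

Lemma prod_natr_expS n d : 0 < n -> \prod_(j < d) n ^+ j.+1 = n `^ (s_crit R d).
Proof.
move=> n0; elim: d => [|d IH]; first by rewrite big_ord0 /s_crit mul0n mul0r powRr0.
rewrite big_ord_recr/= IH -(powR_mulrn d.+1 (ltW n0)) -powR_gt0D//; congr (_ `^ _).
by rewrite /s_crit !natrM -!natr1; field.
Qed.

Lemma s_crit_ge d : (2 <= d)%N ->
  d%:R + 1 <= s_crit R d /\ 3 * d%:R <= 2 * s_crit R d.
Proof.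
move=> d2; have d2R : 2 <= d%:R :> R by rewrite ler_nat.
by rewrite /s_crit natrM -natr1; split; nra.
Qed.

(** The power [t ^ (2 s - 2)] is nonincreasing in [t] for [s <= 1], so it is smallest at [t = N]. *)
Lemma powR_lower_tangent_le1 s (N t : R) : 0 < s -> s <= 1 -> 0 <= t -> t <= N -> 0 < N ->
  N `^ (2 * s - 2) * t ^+ 2 <= t `^ (2 * s).
Proof.
move=> s0 s1; rewrite le_eqVlt => /predU1P[<-|t0] tN N0.
  by rewrite expr0n/= mulr0 powR_ge0.
rewrite [X in t `^ X](_ : 2 * s = 2 * s - 2 + 2); last by lra.
rewrite (@powR_gt0D t)// (powR_mulrn 2 (ltW t0)) ler_wpM2r ?exprn_ge0 ?(ltW t0)//.
rewrite (_ : 2 * s - 2 = - (2 * (1 - s))); last by lra.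
rewrite !powRN lef_pV2 ?posrE ?powR_gt0//.
by apply: ge0_ler_powR; rewrite ?nnegrE ?(ltW t0) ?(ltW N0)//; lra.
Qed.

(** The left side is at most 0 when [t ^+ 2 <= tau]; beyond that [(t ^+ 2) ^ (s - 1)] is at least
    [tau ^ (s - 1)]. *)
Lemma powR_lower_tangent_ge1 s tau t : 1 <= s -> 0 <= t -> 0 < tau ->
  tau `^ (s - 1) * (t ^+ 2 - tau) <= t `^ (2 * s).
Proof.
move=> s1 t0 tau0; have [tt|tt] := leP (t ^+ 2) tau.
  by apply: (@le_trans _ _ 0); rewrite ?powR_ge0// mulr_ge0_le0 ?powR_ge0// subr_le0.
rewrite powRrM powR_mulrn//.
have t20 : 0 < t ^+ 2 by lra.
have -> : (t ^+ 2) `^ s = (t ^+ 2) `^ (s - 1) * t ^+ 2.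
  by rewrite -[X in _ * X]powRr1 ?(ltW t20)// -powR_gt0D// subrK.
apply: (@le_trans _ _ (tau `^ (s - 1) * t ^+ 2)).
  by rewrite ler_wpM2l ?powR_ge0// lerBlDr lerDl ltW.
rewrite ler_wpM2r ?exprn_ge0//.
by apply: ge0_ler_powR; rewrite ?nnegrE ?exprn_ge0 ?(ltW tau0) ?(ltW tt)//; lra.
Qed.

(** It allows [X] to be replaced by [N]: for [y < 0] the left maximum is 1, otherwise the power is
    monotone. *)
Lemma max1_powR_le (X n y : R) : 1 <= X -> X <= n -> Num.max 1 (X `^ y) <= Num.max 1 (n `^ y).
Proof.
move=> X1 Xn; have [y0|y0] := leP 0 y.
  rewrite ge_max le_max lexx/= le_max; apply/orP; right.
  by apply: ge0_ler_powR; rewrite ?nnegrE//; lra.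
rewrite ge_max !le_max lexx/=; apply/orP; left.
by rewrite -(powRr0 X); apply: ler_powR => //; exact: ltW.
Qed.

(* [X] stands for [delta^(1/nu) N]. *)
Lemma mean_value_ge_small_s d s delta eps (X : R) (xi : d.-tuple R) (N : nat) :
  (2 <= d)%N -> 0 < s -> s <= s_crit R d -> 0 < delta -> delta <= 1 ->
  1 <= X -> X <= N%:R -> 32 <= N%:R * delta ^+ 2 -> 2 ^+ d.+3 <= N%:R :> R ->
  N%:R `^ (- eps) <= (4 ^+ d.+1)^-1 * Num.min 1 ((2 ^+ d.+3)^-1 `^ (s - 1)) ->
  ((delta ^+ d * N%:R `^ (d%:R + s - s_crit R d - eps)
        * Num.max 1 (X `^ (s - d%:R)))%:E <= mean_value s delta xi N)%E.
Proof.
move=> d2 s0 sc de0 de1 X1 Xn hN N2 Neps.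
set n : R := N%:R in X1 Xn hN N2 Neps *.
have [sc1 _] := s_crit_ge d2.
have d2R : 2 <= d%:R :> R by rewrite ler_nat.
have n1 : 1 <= n by lra.
have n0 : 0 < n by lra.
have p0 : 0 < 2 ^+ d.+3 :> R by rewrite exprn_gt0.
(* Half of the room N / 2^(d+2) goes to [tau]; the other half is at least 1. *)
pose tau := n / 2 ^+ d.+3.
have tau0 : 0 < tau by rewrite divr_gt0.
have htau : 1 + tau <= n / 2 ^+ d.+2.
  have : 1 <= tau by rewrite ler_pdivlMr// mul1r.
  rewrite (_ : n / 2 ^+ d.+2 = 2 * tau); first by lra.
  by rewrite /tau [2 ^+ d.+3]exprS; field; rewrite expf_neq0.
(* Here [A] is the slope of the minorant, of size at least [c * n ^ (E - 1)], and [E] is the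
   resulting exponent of [n]. *)
have main A c E : 0 <= A ->
    (forall t, 0 <= t -> t <= n -> A * (t ^+ 2 - tau) <= t `^ (2 * s)) ->
    n `^ (- eps) <= (4 ^+ d.+1)^-1 * c -> c * n `^ (E - 1) <= A ->
    n `^ (d%:R + s - s_crit R d) * Num.max 1 (n `^ (s - d%:R)) <= n `^ E ->
    ((delta ^+ d * n `^ (d%:R + s - s_crit R d - eps)
        * Num.max 1 (X `^ (s - d%:R)))%:E <= mean_value s delta xi N)%E.
  move=> A0 hA hc cA hE.
  apply: le_trans (mean_value_ge_mean_square xi d2 de0 de1 hN A0 hA htau).
  rewrite lee_fin -/n exprMn exprVn -mulrA [leRHS]mulrCA ler_wpM2l ?exprn_ge0 ?(ltW de0)//.
  rewrite (@powR_gt0D n (d%:R + s - s_crit R d) (- eps) n0) mulrAC.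
  apply: (@le_trans _ _ (n `^ E * n `^ (- eps))).
    rewrite ler_wpM2r ?powR_ge0//; apply: le_trans hE.
    by rewrite ler_wpM2l ?powR_ge0// max1_powR_le.
  apply: (@le_trans _ _ (n `^ E * ((4 ^+ d.+1)^-1 * c))); first by rewrite ler_wpM2l ?powR_ge0.
  rewrite [n `^ E](_ : _ = n * n `^ (E - 1)); last first.
    by rewrite -[X in _ = X * _](powRr1 (ltW n0)) -powR_gt0D//; congr (_ `^ _); lra.
  rewrite [leLHS](_ : _ = c * n `^ (E - 1) * (n * (4 ^+ d.+1)^-1)); last by ring.
  rewrite [leRHS](_ : _ = A * (n * (4 ^+ d.+1)^-1)).
    by rewrite ler_wpM2r// mulr_ge0 ?invr_ge0 ?exprn_ge0// ltW.
  by rewrite [4 ^+ d.+1]exprS; field; rewrite expf_neq0.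
have c0 (c : R) : c = 1 \/ c = (2 ^+ d.+3)^-1 `^ (s - 1) ->
    n `^ (- eps) <= (4 ^+ d.+1)^-1 * c.
  move=> hc; apply: (le_trans Neps); rewrite ler_wpM2l ?invr_ge0 ?exprn_ge0//.
  by case: hc => ->; rewrite ge_min lexx ?orbT.
have [s1|s1] := leP s 1.
  apply: (main (n `^ (2 * s - 2)) 1 (2 * s - 1)); rewrite ?powR_ge0//.
  - move=> t t0 tn; apply: le_trans (powR_lower_tangent_le1 s0 s1 t0 tn n0).
    by rewrite ler_wpM2l ?powR_ge0// lerBlDr lerDl ltW.
  - by apply: c0; left.
  - by rewrite mul1r (_ : 2 * s - 1 - 1 = 2 * s - 2)//; lra.
  rewrite max_l ?mulr1; last by rewrite -[leRHS](powRr0 n); apply: ler_powR => //; lra.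
  by apply: ler_powR => //; lra.
apply: (main (tau `^ (s - 1)) ((2 ^+ d.+3)^-1 `^ (s - 1)) s); rewrite ?powR_ge0//.
- by move=> t t0 tn; apply: powR_lower_tangent_ge1 => //; exact: ltW.
- by apply: c0; right.
- by rewrite /tau mulrC powRM ?invr_ge0 ?exprn_ge0// ltW.
(* The second term of the maximum has exponent 2 s - s(d), which is at most [s] exactly because
   [s <= s(d)]. *)
rewrite maxr_pMr ?powR_ge0// mulr1 ge_max -powR_gt0D//.
by apply/andP; split; apply: ler_powR => //; lra.
Qed.

(** With [q] of order [1 / delta], the single box gives the required power of [N], and [delta] to
    the power s + d/2. The target has exponent d + (s - d) / nu, which is larger, so the box
    suffices as [delta <= 1]. *)
Lemma mean_value_ge_large_s d k s delta eps (c : R) (xi : d.-tuple R) (N : nat) :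
  (2 <= d)%N -> (1 <= k <= d)%N -> s_crit R d <= s -> torus xi -> 0 < delta -> delta <= 1 ->
  1 <= delta `^ (nu R d k)^-1 * N%:R -> 15 ^+ 3 <= N%:R * delta ^+ 3 ->
  0 < c -> c * (256 * d%:R) <= 1 -> N%:R `^ (- eps) <= (16^-1) `^ (2 * s) * c ^+ d ->
  ((delta ^+ d * N%:R `^ (d%:R + s - s_crit R d - eps)
        * Num.max 1 ((delta `^ (nu R d k)^-1 * N%:R) `^ (s - d%:R)))%:E
   <= mean_value s delta xi N)%E.
Proof.
move=> d2 hk ss xiT de0 de1 X1 hN c0 hc Neps.
set n : R := N%:R in X1 hN Neps *.
have [sc1 sc2] := s_crit_ge d2.
have [nu0 nu3] := nu_gt0_le d2 hk.
have d2R : 2 <= d%:R :> R by rewrite ler_nat.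
have d3 : delta ^+ 3 <= 1 by rewrite exprn_ile1// ltW.
have n0' : 0 <= n by rewrite ler0n.
have n1 : 16 <= n by nra.
have n0 : 0 < n by lra.
(* The least [m] with [delta * 3 ^ m >= 5]; minimality costs a factor 3 at most. *)
have [m hm] : exists m : nat, 5 <= delta * (3 ^ m)%:R /\ delta * (3 ^ m)%:R <= 15.
  have ex : exists m, 5 <= delta * (3 ^ m)%:R.
    exists (Num.truncn (5 / delta)).+1.
    have /truncn_itv/andP[_ /ltW h] : 0 <= 5 / delta by rewrite divr_ge0// ltW.
    rewrite mulrC -ler_pdivrMr//; apply: (le_trans h); rewrite ler_nat.
    by apply: ltnW; exact: ltn_expl.
  case: (ex_minnP ex) => m hm min; exists m; split => //.
  case: m hm min => [|m] hm min; first by rewrite expn0 mulr1; lra.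
  have : ~~ (5 <= delta * (3 ^ m)%:R) by apply/negP => /min; rewrite ltnn.
  by rewrite -ltNge expnS natrM; lra.
case: hm => hm5 hm15.
have := @mean_value_ge_rational R d s delta xi m N d2.
set q : R := (3 ^ m)%:R in hm5 hm15 *; set r := Num.sqrt q => /(_ _ xiT de1 hm5).
have q0 : 0 < q by rewrite ltr0n expn_gt0.
have rr : r ^+ 2 = q by rewrite sqr_sqrtr// ltW.
have r0 : 0 < r by rewrite sqrtr_gt0.
(* Combining [delta * q <= 15] with 15^3 <= N delta^3; the square of 4 q sqrt q is then at most 16
   N, hence at most N^2. *)
have q3 : q ^+ 3 <= n.
  have : (delta * q) ^+ 3 <= 15 ^+ 3.
    by rewrite lerXn2r ?nnegrE//; rewrite mulr_ge0// ltW.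
  rewrite exprMn => h; rewrite -(ler_pM2l (exprn_gt0 3 de0)).
  by apply: (le_trans h); rewrite mulrC; lra.
have hqr : 4 * q * r <= n.
  rewrite -(@ler_sqr _ (4 * q * r)) ?nnegrE//; last by rewrite !mulr_ge0// ltW.
  rewrite exprMn rr; nra.
have s0 : 0 <= s by lra.
move=> /(_ s0 hqr); apply: le_trans; rewrite lee_fin.
set w := Num.sqrt delta.
have w0 : 0 < w by rewrite sqrtr_gt0.
have ww : w ^+ 2 = delta by rewrite sqr_sqrtr// ltW.
have rw : r * w <= 4.
  rewrite -(@ler_sqr _ (r * w)) ?nnegrE//; last by rewrite mulr_ge0// ltW.
  rewrite exprMn rr ww; lra.
rewrite prodf_div prodr_const card_ord prod_natr_expS//.
have h1 : 16^-1 `^ (2 * s) * n `^ (2 * s) * w `^ (2 * s) <= (n / (4 * r)) `^ (2 * s).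
  rewrite -!powRM ?mulr_ge0 ?invr_ge0 ?(ltW w0)//.
  apply: ge0_ler_powR; rewrite ?nnegrE ?mulr_ge0 ?invr_ge0 ?mulr_ge0 ?(ltW w0) ?(ltW r0)//.
  rewrite ler_pdivlMr ?mulr_gt0//.
  rewrite (_ : _ * (4 * r) = n * ((r * w) / 4)); last by field.
  by rewrite ler_piMr//; lra.
have h2 : c ^+ d * w ^+ d <= (64 * d%:R * r)^-1 ^+ d.
  have dr0 : 0 < 64 * d%:R * r by rewrite mulr_gt0//; lra.
  rewrite -exprMn; apply: lerXn2r; rewrite ?nnegrE ?invr_ge0 ?(ltW dr0)//.
    by rewrite mulr_ge0 ?(ltW c0) ?(ltW w0).
  rewrite -[leRHS]div1r ler_pdivlMr//.
  have -> : c * w * (64 * d%:R * r) = c * (256 * d%:R) * (r * w / 4) by field.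
  have : 0 <= r * w by rewrite mulr_ge0 ?(ltW r0) ?(ltW w0).
  have : 0 <= c * (256 * d%:R) by rewrite mulr_ge0 ?(ltW c0) ?mulr_ge0.
  nra.
have -> : Num.max 1 ((delta `^ (nu R d k)^-1 * n) `^ (s - d%:R)) =
    delta `^ ((nu R d k)^-1 * (s - d%:R)) * n `^ (s - d%:R).
  rewrite max_r; first by rewrite powRM ?powR_ge0// powRrM.
  by rewrite -[leLHS](powRr0 (delta `^ (nu R d k)^-1 * n)); apply: ler_powR => //; lra.
(* Since [w <= 1], it is enough to compare exponents, using 1 / nu >= 3 and 2 s >= 3 d. *)
have h3 : delta ^+ d * delta `^ ((nu R d k)^-1 * (s - d%:R)) <= w `^ (2 * s) * w ^+ d.
  rewrite -(powR_mulrn d (ltW de0)) -(powR_mulrn d (ltW w0)) -!powR_gt0D//.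
  rewrite -ww -(powR_mulrn 2 (ltW w0)) -powRrM; apply: ger_powR.
    by rewrite w0/= -(@ler_sqr _ w 1) ?nnegrE ?(ltW w0)// ww expr1n.
  have : 3 * (s - d%:R) <= (nu R d k)^-1 * (s - d%:R).
    by rewrite ler_wpM2r ?subr_ge0//; [lra|rewrite -[leRHS]div1r ler_pdivlMr].
  lra.
have nE : n `^ (d%:R + s - s_crit R d - eps) * n `^ (s - d%:R) =
    n `^ (2 * s) / n `^ (s_crit R d) * n `^ (- eps).
  by rewrite -powRN -!powR_gt0D//; congr (_ `^ _); lra.
apply: (@le_trans _ _ ((n `^ (2 * s) / n `^ (s_crit R d)) *
    ((16^-1 `^ (2 * s) * c ^+ d) * (w `^ (2 * s) * w ^+ d)))).
  rewrite [leLHS](_ : _ = (n `^ (d%:R + s - s_crit R d - eps) * n `^ (s - d%:R)) *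
    (delta ^+ d * delta `^ ((nu R d k)^-1 * (s - d%:R)))); last by ring.
  rewrite nE -[leLHS]mulrA ler_wpM2l ?mulr_ge0 ?invr_ge0 ?powR_ge0//.
  apply: ler_pM => //; rewrite ?powR_ge0//.
  by rewrite mulr_ge0 ?powR_ge0 ?exprn_ge0 ?(ltW de0).
rewrite [leLHS](_ : _ = (16^-1 `^ (2 * s) * n `^ (2 * s) * w `^ (2 * s)) *
  (c ^+ d * w ^+ d / n `^ (s_crit R d))); last by ring.
apply: ler_pM => //.
- by rewrite !mulr_ge0 ?powR_ge0.
- by rewrite mulr_ge0 ?invr_ge0 ?powR_ge0// mulr_ge0 ?exprn_ge0 ?(ltW c0) ?(ltW w0).
- by rewrite ler_wpM2r ?invr_ge0 ?powR_ge0.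
Qed.

End Exponents.

(** * The constant, the threshold, and the union of the two regimes *)

Theorem theorem3p10 (R : realType) (d k : nat)
    (hd : (2 <= d)%N) (hk : (1 <= k <= d)%N) :
  exists C : R, 0 < C /\
    forall s : R, 0 < s ->
    forall eps : R, 0 < eps ->
    exists N0 : nat, forall N : nat, (N0 <= N)%N ->
    forall delta : R, 0 < delta ->
      C * N%:R `^ (- nu R d k) * ln N%:R <= delta -> delta <= 1 ->
      ((delta ^+ d * N%:R `^ (d%:R + s - s_crit R d - eps)
        * Num.max 1 ((delta `^ (nu R d k)^-1 * N%:R) `^ (s - d%:R)))%:E
       <= inf_mean_value d s delta N)%E.
Proof.
(* As ln N >= 1 for large N, [delta] is at least 15 N^(-nu), and 3 nu <= 1 turns this into N delta^3
   >= 15^3. *)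
exists 15; split=> // s s0 eps eps0.
have [nu0 nu3] := @nu_gt0_le R _ _ hd hk.
have [N1 hN1] : exists N1 : nat, forall N, (N1 <= N)%N ->
    N%:R `^ (- eps) <= (4 ^+ d.+1)^-1 * Num.min 1 ((2 ^+ d.+3)^-1 `^ (s - 1)).
  exact: powRN_eventually_le.
have d0R : 0 < 256 * d%:R :> R by apply: mulr_gt0; rewrite ltr0n// ltnW.
have [c c0 hc] : exists2 c, 0 < c & c * (256 * d%:R) <= 1 :> R.
  by exists (256 * d%:R)^-1; rewrite ?invr_gt0 ?mulVf ?(gt_eqF d0R).
have [N2 hN2] : exists N2 : nat, forall N, (N2 <= N)%N ->
    N%:R `^ (- eps) <= (16^-1) `^ (2 * s) * c ^+ d :> R.
  apply: powRN_eventually_le eps0 _; apply: mulr_gt0; last by rewrite exprn_gt0.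
  by rewrite powR_gt0// invr_gt0.
pose N3 := (Num.truncn (expR 1 : R)).+1.
(* [N1] and [N2] absorb the constants of the two regimes, [N3] gives N >= e, and the power of 2
   ensures [tau >= 1] for small [s]. *)
exists (maxn (maxn N1 N2) (maxn N3 (2 ^ d.+3))) => N.
rewrite !geq_max => /andP[/andP[N1N N2N] /andP[N3N dN]] delta de0 hde de1.
have n3 : expR 1 <= N%:R :> R.
  have /truncn_itv/andP[_ /ltW h] := expR_ge0 (1 : R).
  by apply: (le_trans h); rewrite ler_nat.
have n2 : 2 ^+ d.+3 <= N%:R :> R by rewrite -natrX ler_nat.
have n0 : 0 < N%:R :> R by apply: lt_le_trans n3; rewrite expR_gt0.
have ln1 : 1 <= ln N%:R :> R by rewrite -[leLHS]expRK ler_ln ?posrE ?expR_gt0.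
have n1 : 1 <= N%:R :> R by apply: le_trans n2; rewrite exprn_ege1//; lra.
have de15 : 15 * N%:R `^ (- nu R d k) <= delta.
  by apply: le_trans hde; rewrite ler_peMr ?mulr_ge0 ?powR_ge0.
have X1 : 1 <= delta `^ (nu R d k)^-1 * N%:R.
  have : (N%:R `^ (- nu R d k)) `^ (nu R d k)^-1 <= delta `^ (nu R d k)^-1.
    apply: ge0_ler_powR; rewrite ?nnegrE ?powR_ge0 ?invr_ge0 ?(ltW nu0) ?(ltW de0)//.
    by have := powR_ge0 (N%:R : R) (- nu R d k); lra.
  by rewrite -powRrM mulNr mulfV ?gt_eqF// powR_inv1 ?(ltW n0)// -[leLHS]div1r ler_pdivrMr.
have Xn : delta `^ (nu R d k)^-1 * N%:R <= N%:R.
  rewrite ler_piMl ?(ltW n0)// -[leRHS](powRr0 delta); apply: ger_powR; first by rewrite de0.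
  by rewrite invr_ge0 ltW.
have hN3 : 15 ^+ 3 <= N%:R * delta ^+ 3.
  have h : (15 * N%:R `^ (- nu R d k)) ^+ 3 <= delta ^+ 3.
    by rewrite lerXn2r ?nnegrE ?mulr_ge0 ?powR_ge0 ?(ltW de0).
  have h' : N%:R^-1 <= (N%:R `^ (- nu R d k)) ^+ 3.
    rewrite -[leLHS]powR_inv1 ?(ltW n0)// -[leRHS]powR_mulrn ?powR_ge0// -powRrM.
    by apply: ler_powR => //; rewrite mulNr lerN2; lra.
  rewrite mulrC -ler_pdivrMr//; apply: le_trans h; rewrite exprMn.
  by rewrite ler_wpM2l ?exprn_ge0.
have hN2' : 32 <= N%:R * delta ^+ 2.
  have : N%:R * delta ^+ 3 <= N%:R * delta ^+ 2.
    by rewrite ler_wpM2l ?(ltW n0)// exprS ler_piMl ?exprn_ge0// ltW.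
  lra.
apply: le_ereal_inf_tmp => _ [xi xiT <-].
have [sc|sc] := leP s (s_crit R d).
  by apply: (mean_value_ge_small_s xi hd s0 sc de0 de1 X1 Xn hN2' n2); exact: hN1.
by apply: (mean_value_ge_large_s hd hk (ltW sc) xiT de0 de1 X1 hN3 c0 hc); exact: hN2.
Qed.
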